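(* Let $s>1/2$. Then there is a continuous embedding $H^s_{\psi,\omega}\hookrightarrow C^0_{\psi,\omega}(\mathbb{R})$. Explicitly, if $u\in H^s_{\psi,\omega}$, then $u$ corresponds to a continuous function satisfying $$|u(t)|\le\frac{C_s}{\omega(t)}\,\|u\|_{H^s_{\psi,\omega}}\qquad\text{for all }t\in\mathbb{R},$$ where $C_s$ is the embedding constant of the classical space $H^s(\mathbb{R})$, i.e. a constant with $\|v\|_{L^\infty(\mathbb{R})}\le C_s\|v\|_{H^s(\mathbb{R})}$ for all $v\in H^s(\mathbb{R})$.
   Context: Standing assumptions: $\psi:\mathbb{R}\to\mathbb{R}$ is a $C^\infty$-diffeomorphism, strictly increasing, with $\psi'(t)>0$ for all $t\in\mathbb{R}$; $\omega:\mathbb{R}\to(0,\infty)$ is $C^\infty$, and $\omega$ and all its derivatives have at most polynomial growth. Put $(T\phi)(y)=\omega(\psi^{-1}(y))\,\phi(\psi^{-1}(y))$. The weighted derivative is $\mathfrak{D}_{\psi,\omega}\phi(t)=\frac{1}{\omega(t)\psi'(t)}\frac{d}{dt}\big(\omega(t)\phi(t)\big)$. The weighted Schwartz space $\mathcal{S}_{\psi,\omega}$ is the space of all $\phi\in C^\infty(\mathbb{R})$ such that $\sup_{t\in\mathbb{R}}\big|\psi(t)^k\,\omega(t)\,\mathfrak{D}_{\psi,\omega}^m\phi(t)\big|<\infty$ for all $k,m\in\mathbb{N}_0$, with the topology generated by these seminorms (equivalently, $T\phi\in\mathcal{S}(\mathbb{R})$, with the transported topology). $\mathcal{S}'_{\psi,\omega}$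 is its topological dual, with duality pairing $(\cdot,\cdot)_{\psi,\omega}$. The operator $T$ extends to $T:\mathcal{S}'_{\psi,\omega}\to\mathcal{S}'(\mathbb{R})$ by $\langle Tu,g\rangle=(u,T^{-1}g)_{\psi,\omega}$ for $g\in\mathcal{S}(\mathbb{R})$. A function $u$ is identified with the functional $\phi\mapsto\int_{\mathbb{R}}u\,\phi\,\omega^2\psi'\,dt$. $\mathcal{F}$ is the classical Fourier transform on $\mathcal{S}'(\mathbb{R})$ in its unitary normalization, $\mathcal{F}v(\xi)=(2\pi)^{-1/2}\int_{\mathbb{R}}e^{-i\xi y}v(y)\,dy$ for $v\in\mathcal{S}(\mathbb{R})$, and the weighted Fourier transform is $\mathcal{F}_{\psi,\omega}[u]=\mathcal{F}[Tu]$. For $s\in\mathbb{R}$, $H^s_{\psi,\omega}$ is the space of $u\in\mathcal{S}'_{\psi,\omega}$ such that $\mathcal{F}_{\psi,\omega}[u]$ is a locally integrable function and $\|u\|_{H^s_{\psi,\omega}}^2=\int_{\mathbb{R}}(1+|\xi|^2)^s|\mathcal{F}_{\psi,\omega}[u](\xi)|^2\,d\xi<\infty$. The classical $H^s(\mathbb{R})$ carries the norm $\|v\|_{H^s(\mathbb{R})}^2=\int_{\mathbb{R}}(1+|\xi|^2)^s|\mathcal{F}v(\xi)|^2\,d\xi$. $C^0_{\psi,\omega}(\mathbb{R})$ is the space of continuous functions $u$ on $\mathbb{R}$ with $\sup_{t}\omega(t)|u(t)|<\infty$, normed by this supremum. *)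

(* Defs.v *)
From mathcomp Require Import all_boot all_order all_algebra.
From mathcomp Require Import all_classical all_reals all_analysis.
From mathcomp Require Import complex.

Set Implicit Arguments.
Unset Strict Implicit.
Unset Printing Implicit Defensive.

Import Order.TTheory GRing.Theory Num.Theory.
Import numFieldNormedType.Exports.
(* [normc z : R] is the modulus of [z : R[i]]; the norm [`|z|] lies in [R[i]]. *)
Export Normc.

Local Open Scope classical_set_scope.
Local Open Scope ring_scope.
Local Open Scope complex_scope.

Section complex_valued.
Context {R : realType}.
Implicit Types f : R -> R[i].

Definition smooth (f : R -> R) :=
  forall n t, derivable (derive1n n f) t 1.

(* [R[i]] is not a normed module over [R] in the library, so the derivative,
   integrability and integral of complex-valued functions of a real variable
   are taken componentwise. *)
Definition reF f : R -> R := fun t => complex.Re (f t).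
Definition imF f : R -> R := fun t => complex.Im (f t).

Definition csmooth f := smooth (reF f) /\ smooth (imF f).

Definition cderiv f : R -> R[i] := fun t =>
  derive1 (reF f) t +i* derive1 (imF f) t.

Definition cintegrable f :=
  lebesgue_measure.-integrable setT (EFin \o reF f) /\
  lebesgue_measure.-integrable setT (EFin \o imF f).

Definition cintegral f : R[i] :=
  Rintegral lebesgue_measure setT (reF f) +i*
  Rintegral lebesgue_measure setT (imF f).

Definition clocally_integrable f :=
  locally_integrable setT (reF f) /\ locally_integrable setT (imF f).

End complex_valued.

Section functionals.
Context {R : realType}.

(* A functional on a space [S] of test functions is represented by a total
   map on all functions, of which only the values on [S] matter: two
   functionals are the same element of the dual when they agree on [S]. *)
Definition functional := (R -> R[i]) -> R[i].

Definition same_on (S : set (R -> R[i])) (u v : functional) :=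
  forall phi, S phi -> u phi = v phi.

Definition linear_on (S : set (R -> R[i])) (u : functional) :=
  forall (a : R[i]) phi chi, S phi -> S chi ->
    u (fun t => a * phi t + chi t) = a * u phi + u chi.

(* Basic neighbourhoods of [phi0] in the topology generated by the seminorms
   [p k m] are finite intersections of balls for these seminorms. *)
Definition continuous_on (S : set (R -> R[i]))
    (p : nat -> nat -> (R -> R[i]) -> \bar R) (u : functional) :=
  forall phi0, S phi0 -> forall e : R, 0 < e ->
    exists (F : seq (nat * nat)) (d : R), 0 < d /\
      forall phi, S phi ->
        (forall km, km \in F ->
           (p km.1 km.2 (fun t => phi t - phi0 t)%R < d%:E)%E) ->
        normc (u phi - u phi0) < e.

Definition topological_dual (S : set (R -> R[i]))
    (p : nat -> nat -> (R -> R[i]) -> \bar R) : set functional :=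
  [set u | linear_on S u /\ continuous_on S p u].

(* The functional [u] on [S] is [phi |-> \int f phi w dt]. *)
Definition is_function (S : set (R -> R[i])) (w : R -> R)
    (u : functional) (f : R -> R[i]) :=
  forall phi, S phi ->
    cintegrable (fun t => f t * phi t * (w t)%:C) /\
    u phi = cintegral (fun t => f t * phi t * (w t)%:C).

End functionals.
Arguments functional : clear implicits.

Section classical_spaces.
Context {R : realType}.

Definition schwartz_seminorm (k m : nat) (g : R -> R[i]) : \bar R :=
  ereal_sup (range (fun y => (normc ((y ^+ k)%:C * iter m cderiv g y))%:E)).

Definition schwartz : set (R -> R[i]) :=
  [set g | csmooth g /\ forall k m, (schwartz_seminorm k m g < +oo)%E].

Definition tempered : set (functional R) :=
  topological_dual schwartz schwartz_seminorm.

Definition fourier (g : R -> R[i]) : R -> R[i] := fun xi =>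
  ((Num.sqrt (2 * pi))^-1)%:C *
  cintegral (fun y => (cos (xi * y) -i* sin (xi * y)) * g y).

Definition fourier_dist (v : functional R) : functional R :=
  fun g => v (fourier g).

Definition is_locint_function (v : functional R) (h : R -> R[i]) :=
  clocally_integrable h /\ is_function schwartz (fun=> 1) v h.

(* The function that the distribution [v] is, which is determined almost
   everywhere; an arbitrary representative is chosen. *)
Definition function_of (v : functional R) : R -> R[i] :=
  xget (fun=> 0) [set h | is_locint_function v h].

Definition sobolev_energy (s : R) (h : R -> R[i]) : \bar R :=
  (\int[lebesgue_measure]_xi
     ((1 + `|xi| ^+ 2) `^ s * normc (h xi) ^+ 2)%:E)%E.

Definition sobolev (s : R) : set (functional R) :=
  [set v | [/\ tempered v, exists h, is_locint_function (fourier_dist v) h &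
    (sobolev_energy s (function_of (fourier_dist v)) < +oo)%E]].

Definition sobolev_norm (s : R) (v : functional R) : R :=
  Num.sqrt (fine (sobolev_energy s (function_of (fourier_dist v)))).

(* [f] is the function identified with the distribution [v], so that
   [||v||_{L^oo}] is the essential supremum of [|f|]. *)
Definition sobolev_embedding_constant (s Cs : R) :=
  forall v f, sobolev s v -> is_locint_function v f ->
    ('N[lebesgue_measure]_+oo [EFin \o (fun x => normc (f x))]
       <= (Cs * sobolev_norm s v)%:E)%E.

End classical_spaces.

Section weighted_spaces.
Context {R : realType}.
Variables (psi psiV omega : R -> R).

Definition increasing_diffeo :=
  [/\ smooth psi /\ smooth psiV, cancel psi psiV /\ cancel psiV psi,
      {homo psi : x y / x < y} & forall t, 0 < derive1 psi t].

Definition polynomial_growth (f : R -> R) :=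
  exists (C : R) (N : nat), forall t, `|f t| <= C * (1 + `|t|) ^+ N.

Definition admissible_weight :=
  [/\ forall t, 0 < omega t, smooth omega &
      forall n, polynomial_growth (derive1n n omega)].

Definition wT (phi : R -> R[i]) : R -> R[i] :=
  fun y => (omega (psiV y))%:C * phi (psiV y).

Definition wTinv (g : R -> R[i]) : R -> R[i] :=
  fun t => ((omega t)^-1)%:C * g (psi t).

Lemma wTK : increasing_diffeo -> admissible_weight -> cancel wT wTinv.
Proof.
move=> [_ [psiK _] _ _] [omega_gt0 _ _] phi; apply/funext => t.
by rewrite /wT /wTinv psiK mulrA -rmorphM/= mulVf ?gt_eqF// mul1r.
Qed.

Lemma wTinvK : increasing_diffeo -> admissible_weight -> cancel wTinv wT.
Proof.
move=> [_ [_ psiVK] _ _] [omega_gt0 _ _] g; apply/funext => y.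
by rewrite /wT /wTinv psiVK mulrA -rmorphM/= mulfV ?gt_eqF// mul1r.
Qed.

Definition wderiv (phi : R -> R[i]) : R -> R[i] := fun t =>
  ((omega t * derive1 psi t)^-1)%:C * cderiv (fun x => (omega x)%:C * phi x) t.

Definition wseminorm (k m : nat) (phi : R -> R[i]) : \bar R :=
  ereal_sup (range (fun t =>
    (normc ((psi t ^+ k * omega t)%:C * iter m wderiv phi t))%:E)).

Definition wschwartz : set (R -> R[i]) :=
  [set phi | csmooth phi /\ forall k m, (wseminorm k m phi < +oo)%E].

Definition wdual : set (functional R) := topological_dual wschwartz wseminorm.

(* The extension of [wT] to the dual space, by transposition. *)
Definition wT_dist (u : functional R) : functional R := fun g => u (wTinv g).

Definition wfourier (u : functional R) : functional R :=
  fourier_dist (wT_dist u).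

Definition wis_function (u : functional R) (f : R -> R[i]) :=
  is_function wschwartz (fun t => omega t ^+ 2 * derive1 psi t) u f.

Definition wsobolev (s : R) : set (functional R) :=
  [set u | [/\ wdual u, exists h, is_locint_function (wfourier u) h &
    (sobolev_energy s (function_of (wfourier u)) < +oo)%E]].

Definition wsobolev_norm (s : R) (u : functional R) : R :=
  Num.sqrt (fine (sobolev_energy s (function_of (wfourier u)))).

Definition C0_norm (f : R -> R[i]) : \bar R :=
  ereal_sup (range (fun t => (omega t * normc (f t))%:E)).

Definition C0_space : set (R -> R[i]) :=
  [set f | continuous (f : R -> (R[i])^o) /\ (C0_norm f < +oo)%E].

End weighted_spaces.

(* Main.v *)
Require Import Defs.
From mathcomp Require Import all_boot all_order all_algebra.
From mathcomp Require Import all_classical all_reals all_analysis.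
From mathcomp Require Import complex.
From mathcomp Require Import measurable_realfun ess_sup_inf.
From mathcomp Require Import ring lra zify.

(** The operator [wT] is the change of variable [y = psi t] combined with a
    multiplication by the weight. It turns the weighted derivative into the
    ordinary one ([wderiv_wTinv]) and each weighted seminorm into the
    corresponding Schwartz seminorm ([wseminorm_wTinv]); by transposition it
    maps [H^s_{psi,omega}] into [H^s] without changing the norm. If the
    distribution transported from [u] is a continuous function [f], then
    changing the variable back in [\int f (T phi) dy] gives
    [\int u phi omega^2 psi' dt] with [u(t) = f(psi t) / omega(t)]
    ([wis_function_wTinv]). Hence [omega |u|] and [|f|] have the same supremum,
    and everything reduces to the classical embedding.

    For the classical embedding ([sobolev_function]), let [h] be the Fourier
    transform of [v] in [H^s] and write [h] as [(1 + xi^2)^(s/2) h] times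
    [(1 + xi^2)^(-s/2)]. Both factors are square integrable because [s > 1/2],
    so [h] is integrable with [L^1] norm controlled by the Sobolev norm
    ([sobolev_energy_L1]). Its inverse transform [f] is therefore continuous and
    bounded by this norm, and [v] is the function [f]: testing [v] on a Schwartz
    function [g], which is the Fourier transform of its inverse transform
    ([inverse_fourierK]), gives the pairing of [h] with the inverse transform of
    [g], and Fubini moves the transform from [g] to [h]
    ([cintegral_inverse_fourier_exchange]).

    The facts about the Fourier transform of Schwartz functions used here are
    proved for the real cosine and sine transforms, which are its components.
    Differentiation and multiplication by the variable exchange the two
    transforms, so that Schwartz functions are mapped to Schwartz functions
    ([trig_transform_rschwartz]) and the transforms of the Gaussian solve a
    linear differential equation ([cosT_gauss], [sinT_gauss]). Inversion follows
    by inserting a Gaussian cut-off and letting it widen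
    ([trig_inversion_even], [trig_inversion_odd]). Gaussian windows also show
    that a bounded continuous function is determined by its pairings with
    Schwartz functions ([bounded_continuous_unique]); this makes the embedding
    well defined, linear and injective.

    The bound with an arbitrary embedding constant [Cs] holds at every point,
    not merely almost everywhere, because an essential bound on a continuous
    function is a pointwise bound ([bounded_continuous_normc_le]). *)

Set Implicit Arguments.
Unset Strict Implicit.
Unset Printing Implicit Defensive.

Import Order.TTheory GRing.Theory Num.Theory.
Import numFieldNormedType.Exports.

Local Open Scope classical_set_scope.
Local Open Scope ring_scope.
Local Open Scope complex_scope.

(** * Smooth functions of a real variable *)

Section smooth_functions.
Context {R : realType}.
Implicit Types f g a b : R -> R.

Lemma derivable_idfun t : derivable ((fun x => x) : R -> R) t 1.
Proof. exact: derivable_id. Qed.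

Lemma derivable_cstfun (c : R) t : derivable ((fun=> c) : R -> R) t 1.
Proof. exact: derivable_cst. Qed.

Lemma derivable_add f g t : derivable f t 1 -> derivable g t 1 ->
  derivable (fun x => f x + g x) t 1.
Proof. by move=> df dg; exact: (derivableD df dg). Qed.

Lemma derivable_mul f g t : derivable f t 1 -> derivable g t 1 ->
  derivable (fun x => f x * g x) t 1.
Proof. by move=> df dg; exact: (derivableM df dg). Qed.

Lemma derive1_add f g t : derivable f t 1 -> derivable g t 1 ->
  derive1 (fun x => f x + g x) t = derive1 f t + derive1 g t.
Proof. by move=> df dg; rewrite !derive1E (deriveD df dg). Qed.

Lemma derive1_mul f g t : derivable f t 1 -> derivable g t 1 ->
  derive1 (fun x => f x * g x) t = derive1 f t * g t + f t * derive1 g t.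
Proof.
move=> df dg; rewrite !derive1E; have := deriveM df dg.
by rewrite /GRing.scale/= addrC (mulrC (g t)); exact.
Qed.

Lemma derivable_cont f t : derivable f t 1 -> {for t, continuous f}.
Proof. by move=> df; exact/differentiable_continuous/derivable1_diffP. Qed.

Lemma derivable_compose f g t : derivable f (g t) 1 -> derivable g t 1 ->
  derivable (fun x => f (g x)) t 1.
Proof.
move=> /derivable1_diffP df /derivable1_diffP dg; apply/derivable1_diffP.
exact: (@differentiable_comp _ _ _ _ g f).
Qed.

(** Smoothness by induction on the order: the recursive characterization lets
    products, composites and inverses be treated by the usual formulas for the
    first derivative. *)
Fixpoint derivable_upto n f : Prop := (forall t, derivable f t 1) /\
  if n is n'.+1 then derivable_upto n' (derive1 f) else True.

Lemma smoothP f : smooth f <-> forall n, derivable_upto n f.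
Proof.
split=> [sf n|sf n].
  elim: n f sf => [|n IH] f sf /=; first by split=> // t; exact: (sf 0%N).
  split; first by move=> t; exact: (sf 0%N).
  by apply: IH => k t; have := sf k.+1 t; rewrite derive1Sn.
elim: n f sf => [|n IH] f sf t; first by case: (sf 0%N) => /(_ t).
by rewrite derive1Sn; apply: IH => k; case: (sf k.+1).
Qed.

Lemma derivable_uptoW n f : derivable_upto n.+1 f -> derivable_upto n f.
Proof.
elim: n f => [|n IH] f [df d1f]; first by split.
by split=> //; exact: IH.
Qed.

Lemma derivable_uptoD n f g : derivable_upto n f -> derivable_upto n g ->
  derivable_upto n (fun x => f x + g x).
Proof.
elim: n f g => [|n IH] f g [df Hf] [dg Hg];
  (split; first by move=> t; exact: (derivable_add (df t) (dg t))); first by [].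
rewrite (_ : derive1 _ = (fun x => derive1 f x + derive1 g x)); first exact: IH.
by apply/funext => t; rewrite derive1_add.
Qed.

Lemma derivable_uptoM n f g : derivable_upto n f -> derivable_upto n g ->
  derivable_upto n (fun x => f x * g x).
Proof.
elim: n f g => [|n IH] f g Hf Hg.
  case: Hf Hg => df _ [dg _]; split; last by [].
  by move=> t; exact: (derivable_mul (df t) (dg t)).
have [[df Hf'] [dg Hg']] := (Hf, Hg).
split; first by move=> t; exact: (derivable_mul (df t) (dg t)).
rewrite (_ : derive1 _ = (fun x => derive1 f x * g x + f x * derive1 g x)).
  apply: derivable_uptoD.
    by apply: IH => //; exact: derivable_uptoW.
  by apply: IH => //; exact: derivable_uptoW.
by apply/funext => t; rewrite derive1_mul.
Qed.

Lemma derivable_upto_cst n (c : R) : derivable_upto n (fun=> c).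
Proof.
elim: n c => [|n IH] c; split=> //.
rewrite (_ : derive1 _ = (fun=> 0)) //.
by apply/funext => t; rewrite derive1_cst.
Qed.

Lemma derivable_upto_comp n f g : derivable_upto n f -> derivable_upto n g ->
  derivable_upto n (fun x => f (g x)).
Proof.
elim: n f g => [|n IH] f g Hf Hg.
  case: Hf Hg => df _ [dg _]; split; last by [].
  by move=> t; exact: (derivable_compose (df (g t)) (dg t)).
have [[df Hf'] [dg Hg']] := (Hf, Hg).
split; first by move=> t; exact: (derivable_compose (df (g t)) (dg t)).
rewrite (_ : derive1 _ = (fun x => derive1 f (g x) * derive1 g x)).
  apply: derivable_uptoM => //.
  by apply: IH => //; exact: derivable_uptoW.
by apply/funext => t; rewrite -derive1_comp.
Qed.

Lemma derivable_upto_inv n f : (forall t, f t != 0) -> derivable_upto n f ->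
  derivable_upto n (fun x => (f x)^-1).
Proof.
move=> f0; elim: n => [|n IH] Hf.
  case: Hf => df _; split; last by [].
  by move=> t; exact: (derivableV (f0 t) (df t)).
have [df Hf'] := Hf.
split; first by move=> t; exact: (derivableV (f0 t) (df t)).
rewrite (_ : derive1 _ =
    (fun x => (-1) * derive1 f x * ((f x)^-1 * (f x)^-1))).
  apply: derivable_uptoM.
    by apply: derivable_uptoM => //; exact: derivable_upto_cst.
  by apply: derivable_uptoM; apply: IH; exact: derivable_uptoW.
apply/funext => t; rewrite derive1E (deriveV (f0 t) (df t)).
rewrite /GRing.scale/= derive1E; set d := derive _ _ _; rewrite expr2 invfM; ring.
Qed.

Lemma smooth_derivable f t : smooth f -> derivable f t 1.
Proof. by move=> /(_ 0%N t). Qed.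

Lemma smooth_continuous f : smooth f -> continuous f.
Proof. by move=> sf t; exact/derivable_cont/smooth_derivable. Qed.

Lemma smooth_derive1n n f : smooth f -> smooth (derive1n n f).
Proof. by move=> sf k t; have := sf (k + n)%N t; rewrite /derive1n iterD. Qed.

Lemma smooth_derive1 f : smooth f -> smooth (derive1 f).
Proof. exact: (@smooth_derive1n 1). Qed.

Lemma smoothD f g : smooth f -> smooth g -> smooth (fun x => f x + g x).
Proof.
by move=> /smoothP sf /smoothP sg; apply/smoothP => n; exact: derivable_uptoD.
Qed.

Lemma smoothM f g : smooth f -> smooth g -> smooth (fun x => f x * g x).
Proof.
by move=> /smoothP sf /smoothP sg; apply/smoothP => n; exact: derivable_uptoM.
Qed.

Lemma smooth_cst (c : R) : smooth (fun=> c).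
Proof. by apply/smoothP => n; exact: derivable_upto_cst. Qed.

Lemma smoothZ c f : smooth f -> smooth (fun x => c * f x).
Proof. by apply: smoothM; exact: smooth_cst. Qed.

Lemma smooth_id : smooth (fun x : R => x).
Proof.
apply/smoothP => -[|n]; split=> //; try by move=> t; exact: derivable_id.
rewrite (_ : derive1 (fun x : R => x) = (fun=> 1)); first exact: derivable_upto_cst.
by apply/funext => t; rewrite derive1_id.
Qed.

Lemma smooth_comp f g : smooth f -> smooth g -> smooth (fun x => f (g x)).
Proof.
move=> /smoothP sf /smoothP sg; apply/smoothP => n.
exact: derivable_upto_comp.
Qed.

Lemma smooth_inv f : (forall t, f t != 0) -> smooth f ->
  smooth (fun x => (f x)^-1).
Proof.
by move=> f0 /smoothP sf; apply/smoothP => n; exact: derivable_upto_inv.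
Qed.

Lemma derive1nZ c f n t : smooth f ->
  derive1n n (fun x => c * f x) t = c * derive1n n f t.
Proof.
move=> sf; elim: n t => [|n IH] t //.
rewrite !derive1nS (_ : derive1n n (fun x => c * f x) =
  (fun x => c * derive1n n f x)); last exact/funext.
rewrite (derive1_mul (@derivable_cstfun c t) (sf n t)).
by rewrite derive1_cst mul0r add0r.
Qed.

Lemma derive1nD f g n t : smooth f -> smooth g ->
  derive1n n (fun x => f x + g x) t = derive1n n f t + derive1n n g t.
Proof.
move=> sf sg; elim: n t => [|n IH] t //.
rewrite !derive1nS (_ : derive1n n (fun x => f x + g x) =
  (fun x => derive1n n f x + derive1n n g x)); last exact/funext.
by rewrite derive1_add.
Qed.

Lemma derive1n_mulX f n t : smooth f ->
  derive1n n (fun x => x * f x) t =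
  t * derive1n n f t + n%:R * derive1n n.-1 f t.
Proof.
move=> sf; elim: n t => [|n IH] t; first by rewrite mul0r addr0.
rewrite !derive1nS (_ : derive1n n (fun x => x * f x) = (fun x =>
  x * derive1n n f x + n%:R * derive1n n.-1 f x)); last exact/funext.
have dn k x : derivable (derive1n k f) x 1 by exact: sf.
rewrite derive1_add; [|exact: (@derivable_mul (fun x => x) _ t (@derivable_idfun t) (dn n t))
  |exact: (@derivable_mul (fun=> n%:R) _ t (@derivable_cstfun _ t) (dn n.-1 t))].
rewrite (derive1_mul (@derivable_idfun t) (dn n t)).
rewrite (derive1_mul (@derivable_cstfun _ t) (dn n.-1 t)) derive1_id derive1_cst mul0r add0r mul1r /=.
case: n {IH} => [|n]; first by rewrite !mul0r addr0 addrC mul1r.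
by rewrite /= -!derive1nS (mulrSr 1 n.+1); ring.
Qed.

End smooth_functions.

(** * Integrals over the real line and change of variables *)

Section integrals_on_the_line.
Context {R : realType}.
Local Notation mu := (@lebesgue_measure R).
Local Notation L1 f := (mu.-integrable setT (EFin \o f)).
Local Notation I f := (Rintegral mu setT f).
Implicit Types f g k : R -> R.

Lemma L1_measurable f : L1 f -> measurable_fun setT f.
Proof. by move=> /measurable_int /measurable_EFinP. Qed.

Lemma continuous_measurable f : continuous f -> measurable_fun setT f.
Proof. exact: continuous_measurable_fun. Qed.

Lemma L1_dominated f g : measurable_fun setT f -> L1 g ->
  (forall x, `|f x| <= g x) -> L1 f.
Proof.
move=> mf ig fg; apply: (le_integrable _ _ _ ig) => //.
  exact/measurable_EFinP.
by move=> x _ /=; rewrite lee_fin (le_trans (fg x))// ler_norm.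
Qed.

Lemma L1_add f g : L1 f -> L1 g -> L1 (fun x => f x + g x).
Proof. by move=> jf jg; exact: (integrableD measurableT jf jg). Qed.

Lemma L1_scale c f : L1 f -> L1 (fun x => c * f x).
Proof. by move=> jf; exact: (integrableZl measurableT c jf). Qed.

Lemma L1_opp f : L1 f -> L1 (fun x => - f x).
Proof. by move=> jf; exact: (integrableN jf). Qed.

Lemma L1_sub f g : L1 f -> L1 g -> L1 (fun x => f x - g x).
Proof. by move=> jf jg; apply: L1_add => //; exact: L1_opp. Qed.

Lemma L1_norm f : L1 f -> L1 (fun x => `|f x|).
Proof. exact: integrable_norm. Qed.

Lemma L1_bounded_mul k f C : measurable_fun setT k -> (forall x, `|k x| <= C) ->
  L1 f -> L1 (fun x => k x * f x).
Proof.
move=> mk kC jf; apply: (L1_dominated _ (L1_scale C (L1_norm jf))).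
  by apply: measurable_funM => //; exact: L1_measurable.
by move=> x; rewrite normrM ler_wpM2r.
Qed.

Lemma IZ c f : L1 f -> I (fun x => c * f x) = c * I f.
Proof. exact: RintegralZl. Qed.

Lemma ID f g : L1 f -> L1 g -> I (fun x => f x + g x) = I f + I g.
Proof. exact: RintegralD. Qed.

Lemma IN f : L1 f -> I (fun x => - f x) = - I f.
Proof.
move=> jf; rewrite -mulN1r -IZ//; congr Rintegral; apply/funext => x.
by rewrite mulN1r.
Qed.

Lemma IB f g : L1 f -> L1 g -> I (fun x => f x - g x) = I f - I g.
Proof. by move=> jf jg; rewrite ID ?IN//; exact: L1_opp. Qed.

Lemma I_norm_le f g : measurable_fun setT f -> L1 g ->
  (forall x, `|f x| <= g x) -> `|I f| <= I g.
Proof.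
move=> mf jg fg; have jf := L1_dominated mf jg fg.
apply: (le_trans (le_normr_Rintegral measurableT jf)).
by apply: le_Rintegral => //; exact: L1_norm.
Qed.

Lemma I_dominated_cvg (f_ : nat -> R -> R) f g :
  (forall n, measurable_fun setT (f_ n)) ->
  (forall x, f_ n x @[n --> \oo] --> f x) ->
  L1 g -> (forall n x, `|f_ n x| <= g x) ->
  L1 f /\ I (f_ n) @[n --> \oo] --> I f.
Proof.
move=> mf_ cf jg fg.
have mf : measurable_fun setT f.
  by apply: (measurable_fun_cvg mf_) => x _; exact: cf.
have emf_ n : measurable_fun setT (EFin \o f_ n) by exact/measurable_EFinP.
have emf : measurable_fun setT (EFin \o f) by exact/measurable_EFinP.
have ecf : {ae mu, forall x, setT x -> (EFin \o f_ n) x @[n --> \oo] --> (f x)%:E}.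
  by apply: nearW => x _; apply: cvg_EFin; [exact: nearW|exact: cf].
have efg : {ae mu, forall x n, setT x -> (`|(EFin \o f_ n) x| <= (g x)%:E)%E}.
  by apply: nearW => x n _ /=; rewrite lee_fin.
have [jf _ If] := @dominated_convergence _ (measurableTypeR R) R mu setT measurableT _ _ _ emf_ emf ecf jg efg.
split=> //.
apply: fine_cvg; rewrite fineK//; exact: integrable_fin_num.
Qed.

(** On each interval [[-n, n]] this is substitution on a compact interval. The
    images of these intervals exhaust the line because [psi] is onto, and
    monotone convergence concludes. *)
Lemma ge0_change_of_variables (psi psiV G : R -> R) :
  {homo psi : x y / x < y} -> cancel psiV psi ->
  (forall t, derivable psi t 1) -> continuous (derive1 psi) ->
  continuous G -> (forall x, 0 <= G x) ->
  (\int[mu]_x (G x)%:E = \int[mu]_x (G (psi x) * derive1 psi x)%:E)%E.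
Proof.
move=> incr psiVK dpsi cdpsi cG G0.
have cpsi : continuous psi by move=> x; exact: derivable_cont.
have psi_mono : {mono psi : x y / x <= y} by exact: le_mono.
have d_ge0 x : 0 <= derive1 psi x.
  apply: (@incr_derive1_ge0 _ psi setT); [|by move=> ? ? _ _; exact: incr|].
    by move=> ? _; exact: dpsi.
  by rewrite interiorT.
pose G1 x := G (psi x) * derive1 psi x.
have cG1 : continuous G1.
  move=> x; apply: cvgM; last exact: cdpsi.
  by apply: continuous_comp; [exact: cpsi|exact: cG].
have G1_ge0 x : 0 <= G1 x by exact: mulr_ge0.
pose A (n : nat) : set R := `[psi (- n%:R), psi n%:R]%classic.
pose B (n : nat) : set R := `[- n%:R, n%:R]%classic.
have ndB : nondecreasing_seq B.
  apply/nondecreasing_seqP => n; rewrite subsetEset => x /=.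
  rewrite /B/= !in_itv/= => /andP[nx xn].
  by rewrite (le_trans _ nx) ?lerN2 ?ler_nat//= (le_trans xn)// ler_nat.
have ndA : nondecreasing_seq A.
  apply/nondecreasing_seqP => n; rewrite subsetEset => x /=.
  rewrite /A/= !in_itv/= => /andP[nx xn].
  by rewrite (le_trans _ nx) ?psi_mono ?lerN2 ?ler_nat//= (le_trans xn)//
    psi_mono ler_nat.
have BT : \bigcup_n B n = [set: R].
  apply/seteqP; split=> // x _; exists (Num.truncn `|x|).+1 => //.
  rewrite /B/= in_itv/= -ler_norml.
  exact/ltW/truncnS_gt.
have AT : \bigcup_n A n = [set: R].
  apply/seteqP; split=> // y _.
  have : (\bigcup_n B n) (psiV y) by rewrite BT.
  case=> n _; rewrite /B/= in_itv/= => /andP[h1 h2]; exists n => //.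
  by rewrite /A/= in_itv/= -(psiVK y) !psi_mono h1.
have cvA : (\int[mu]_(x in A n) (G x)%:E @[n --> \oo] -->
    \int[mu]_x (G x)%:E)%E.
  rewrite -AT; apply: ge0_nondecreasing_set_cvg_integral => //.
  - by move=> n; exact: measurable_itv.
  - move=> n; apply/measurable_EFinP/measurable_funTS.
    exact: continuous_measurable.
  - by move=> n x _; rewrite lee_fin.
have cvB : (\int[mu]_(x in B n) (G1 x)%:E @[n --> \oo] -->
    \int[mu]_x (G1 x)%:E)%E.
  rewrite -BT; apply: ge0_nondecreasing_set_cvg_integral => //.
  - by move=> n; exact: measurable_itv.
  - move=> n; apply/measurable_EFinP/measurable_funTS.
    exact: continuous_measurable.
  - by move=> n x _; rewrite lee_fin.
have AB n : (\int[mu]_(x in A n) (G x)%:E = \int[mu]_(x in B n) (G1 x)%:E)%E.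
  rewrite /A /B; apply: integration_by_substitution_increasing.
  - by rewrite (@le_trans _ _ 0) ?oppr_le0 ?ler0n.
  - by move=> x y _ _; exact: incr.
  - by move=> x _; exact: cdpsi.
  - exact: (cvgP _ (cvg_at_right_filter (cdpsi (- n%:R)))).
  - exact: (cvgP _ (cvg_at_left_filter (cdpsi n%:R))).
  - split; first by move=> x _; exact: dpsi.
      exact: (cvg_at_right_filter (cpsi (- n%:R))).
    exact: (cvg_at_left_filter (cpsi n%:R)).
  - exact: continuous_subspaceT.
move: cvA; under eq_fun do rewrite AB; move=> cvA.
exact: (cvg_unique _ cvA cvB).
Qed.

(** The positive and negative parts of a continuous function are continuous and
    nonnegative, and are treated separately. *)
Lemma change_of_variables (psi psiV G : R -> R) :
  {homo psi : x y / x < y} -> cancel psiV psi -> smooth psi ->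
  continuous G -> L1 G ->
  L1 (fun x => G (psi x) * derive1 psi x) /\
  I (fun x => G (psi x) * derive1 psi x) = I G.
Proof.
move=> incr psiVK spsi cG jG.
have dpsi t : derivable psi t 1 by exact: smooth_derivable.
have cdpsi : continuous (derive1 psi) by exact/smooth_continuous/smooth_derive1.
have cpsi : continuous psi by exact: smooth_continuous.
have psi_mono : {mono psi : x y / x <= y} by exact: le_mono.
have d_ge0 x : 0 <= derive1 psi x.
  apply: (@incr_derive1_ge0 _ psi setT); [|by move=> ? ? _ _; exact: incr|].
    by move=> ? _; exact: dpsi.
  by rewrite interiorT.
have cGpsi : continuous (fun x => G (psi x)).
  by move=> x; apply: continuous_comp; [exact: cpsi|exact: cG].
have cG1 : continuous (fun x => G (psi x) * derive1 psi x).
  by move=> x; apply: cvgM; [exact: cGpsi|exact: cdpsi].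
have cnG1 : continuous (fun x => `|G (psi x)| * derive1 psi x).
  by move=> x; apply: cvgM; [exact: (cvg_norm (cGpsi x))|exact: cdpsi].
have cv (H : R -> R) := @ge0_change_of_variables psi psiV H incr psiVK dpsi cdpsi.
split.
  apply/integrableP; split.
    apply/measurable_EFinP; exact: (continuous_measurable cG1).
  case/integrableP : jG => _; rewrite (cv (fun x => `|G x|))//; last first.
    by move=> x; apply: cvg_norm; exact: cG.
  apply: le_lt_trans; apply: ge0_le_integral => //=.
  - apply/measurable_EFinP/measurableT_comp => //.
    exact: continuous_measurable.
  - by apply/measurable_EFinP; exact: (continuous_measurable cnG1).
  - by move=> x _; rewrite lee_fin normrM (ger0_norm (d_ge0 x)).
have pos (H : R -> R) : continuous H ->
    (\int[mu]_x (Num.max (H (psi x) * derive1 psi x) 0)%:E =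
     \int[mu]_x (Num.max (H x) 0)%:E)%E.
  move=> cH; rewrite (cv (fun x => Num.max (H x) 0)).
  - by apply: eq_integral => x _; rewrite maxr_pMl ?mul0r.
  - move=> x; apply: (@continuous_max _ _ H (fun=> 0)); first exact: cH.
    exact: cvg_cst.
  - by move=> x; rewrite le_max lexx orbT.
have cNG : continuous (fun x => - G x) by move=> x; apply: cvgN; exact: cG.
congr fine; rewrite [LHS]integralE [RHS]integralE.
under [in LHS]eq_integral do rewrite funeposE -EFin_max.
under [X in (_ - X)%E = _]eq_integral do
  rewrite funenegE -EFinN -EFin_max -mulNr.
under [in RHS]eq_integral do rewrite funeposE -EFin_max.
under [X in _ = (_ - X)%E]eq_integral do rewrite funenegE -EFinN -EFin_max.
by rewrite (pos G cG) (pos _ cNG).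
Qed.

End integrals_on_the_line.

(** * Decay and boundary terms at infinity *)

Section decay.
Context {R : realType}.
Local Notation mu := (@lebesgue_measure R).
Local Notation L1 f := (mu.-integrable setT (EFin \o f)).
Local Notation I f := (Rintegral mu setT f).
Implicit Types f g k a : R -> R.

Lemma powR_cvgy0 (b : R) : 0 < b -> (1 + x) `^ (- b) @[x --> +oo] --> (0 : R).
Proof.
move=> b0; apply/cvgrPdist_lt => e e0; near=> x.
have x0 : 0 < 1 + x.
  by apply: ltr_pwDl => //; near: x; exact: nbhs_pinfty_ge.
rewrite sub0r normrN ger0_norm ?powR_ge0// /powR gt_eqF//.
rewrite -[ltRHS]lnK ?posrE// ltr_expR mulNr ltrNl -ltr_pdivrMl// mulrC.
rewrite -ltr_expR lnK ?posrE//.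
apply: (@lt_trans _ _ x); last by rewrite ltrDr.
by near: x; exact: nbhs_pinfty_gt.
Unshelve. all: by end_near. Qed.

(** By parity it suffices to integrate over the half-line, where
    [(1 + x)^(1 - r) / (1 - r)] is a primitive vanishing at infinity. *)
Lemma L1_decay (r : R) : 1 < r -> L1 (fun x => (1 + `|x|) `^ (- r)).
Proof.
move=> r1; set f := fun x : R => _.
have r10 : 0 < r - 1 by rewrite subr_gt0.
have p0 (x : R) : 0 < 1 + `|x| by rewrite ltr_pwDl.
have cf : continuous f.
  move=> x; apply: (@continuous_comp _ _ _ (fun x : R => 1 + `|x|)
    (fun y => y `^ (- r))).
    by apply: cvgD; [exact: cvg_cst|exact: norm_continuous].
  apply/differentiable_continuous/derivable1_diffP.
  by apply: derivable_powR; rewrite in_itv/= p0.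
pose F (x : R) := (1 + x) `^ (- (r - 1)) * (- (r - 1)^-1).
have dF (x : R) : -1 < x -> is_derive x 1 F ((1 + x) `^ (- r)).
  move=> x0.
  have x10 : 0 < 1 + x by rewrite addrC -ltrBlDr sub0r.
  have d1 : is_derive x 1 (fun x : R => 1 + x) 1.
    have := is_deriveD (is_derive_cst (1 : R) x 1) (is_derive_id x 1).
    by rewrite add0r.
  have d2 := @is_derive1_comp R (fun y => y `^ (- (r - 1))) (fun x => 1 + x) x
    _ _ (is_derive1_powR (- (r - 1)) x10) d1.
  have := is_deriveM d2 (is_derive_cst (- (r - 1)^-1) x 1).
  rewrite /GRing.scale/= mulr0 mulr1 add0r => d3.
  rewrite (_ : _ `^ (- r) =
    - (r - 1)^-1 * (- (r - 1) * (1 + x) `^ (- (r - 1) - 1))) //.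
  rewrite mulrA mulrNN mulVf ?gt_eqF// mul1r.
  by congr (_ `^ _); ring.
have F0 : F x @[x --> +oo] --> (0 : R).
  rewrite /F -[X in _ --> X](mul0r (- (r - 1)^-1)).
  by apply: cvgMr_tmp; exact: powR_cvgy0.
apply/integrableP; split.
  by apply/measurable_EFinP; exact: (continuous_measurable cf).
under eq_integral => x _ do rewrite /= ger0_norm ?powR_ge0//.
rewrite (@ge0_symfun_integralT _ f)//.
- rewrite (_ : [set x | _] = `[0, +oo[%classic); last first.
    by apply/seteqP; split => x/=; rewrite in_itv/= andbT.
  rewrite (@ge0_continuous_FTC2y _ f F 0 0)//.
  + by rewrite -EFinB -EFinM ltry.
  + by move=> x _; exact: powR_ge0.
  + exact: continuous_subspaceT.
  + by move=> x x0; have [] := dF x (lt_trans (ltrN10 _) x0).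
  + apply: cvg_at_right_filter; apply: derivable_cont.
    by have [] := dF 0 (ltrN10 _).
  + move=> x; rewrite in_itv/= andbT => x0.
    have [_ dFx] := dF x (lt_trans (ltrN10 _) x0).
    by rewrite derive1E dFx /f gtr0_norm.
- by move=> x; exact: powR_ge0.
- by move=> x; rewrite /f/= normrN.
Qed.

Lemma onePsqr_le (x : R) : (1 + `|x|) ^+ 2 <= 2 * (1 + x ^+ 2).
Proof.
have := sqr_ge0 (1 - `|x|); rewrite -[x ^+ 2]real_normK ?num_real//.
by move: `|x| => y; nra.
Qed.

(** Integrating over [[-n, n]] leaves two boundary terms, which the bound on
    [x * f x] makes of order [1 / n]. This replaces integration by parts on the
    whole line. *)
Lemma I_derive1_eq0 f C : smooth f -> (forall x, `|x * f x| <= C) ->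
  L1 (derive1 f) -> I (derive1 f) = 0.
Proof.
move=> sf fC jf.
have cf : continuous f by exact: smooth_continuous.
have cdf : continuous (derive1 f) by exact/smooth_continuous/smooth_derive1.
pose B (n : nat) : set R := `[- n.+1%:R, n.+1%:R]%classic.
have [_ cv] : L1 (derive1 f) /\
    I (fun x => \1_(B n) x * derive1 f x) @[n --> \oo] --> I (derive1 f).
  apply: (@I_dominated_cvg _ _ _ (fun x => `|derive1 f x|)).
  - move=> n; apply: measurable_funM; last exact: continuous_measurable.
    by apply: measurable_indic; exact: measurable_itv.
  - move=> x; apply: cvg_near_cst; near=> n.
    rewrite indicE mem_set ?mul1r// /B/= in_itv/= -ler_norml.
    rewrite (@le_trans _ _ n%:R)// ?ler_nat//.
    by near: n; exact: nbhs_infty_ger.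
  - exact: L1_norm.
  - move=> n x; rewrite normrM ler_piMl// indicE.
    by case: (_ \in _); rewrite ?normr1 ?normr0.
have FTC n : I (fun x => \1_(B n) x * derive1 f x) = f n.+1%:R - f (- n.+1%:R).
  rewrite (_ : (fun x => _) = (derive1 f \_ (B n))); last first.
    apply/funext => x; rewrite patchE indicE.
    by case: ifP => _; rewrite ?mul1r ?mul0r.
  rewrite -Rintegral_mkcond /Rintegral (@continuous_FTC2 _ _ f)//.
  - by rewrite ltrNl (@le_lt_trans _ _ 0) ?oppr_le0 ?ltr0n.
  - exact: continuous_subspaceT.
  - split; first by move=> x _; exact: smooth_derivable.
      exact: (cvg_at_right_filter (cf _)).
    exact: (cvg_at_left_filter (cf _)).
suff cv0 : I (fun x => \1_(B n) x * derive1 f x) @[n --> \oo] --> (0 : R).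
  exact: (cvg_unique _ cv cv0).
under eq_fun do rewrite FTC.
have C0 : 0 <= C by exact: le_trans (fC 0).
have f_le n (s : R) : `|s| = 1 -> `|f (s * n.+1%:R)| <= C * n.+1%:R^-1.
  move=> s1; rewrite ler_pdivlMr ?ltr0n// mulrC.
  have := fC (s * n.+1%:R); rewrite !normrM s1 mul1r.
  by rewrite (ger0_norm (ler0n _ _)).
apply: norm_cvg0; apply: (@squeeze_cvgr _ _ _ _ (fun=> 0)
    (fun n : nat => C * n.+1%:R^-1 + C * n.+1%:R^-1)).
- apply: nearW => n; rewrite normr_ge0/= (le_trans (ler_normB _ _))// lerD//.
    by have := f_le n 1; rewrite mul1r normr1; exact.
  by have := f_le n (-1); rewrite mulN1r normrN1; exact.
- exact: cvg_cst.
rewrite -[X in _ --> X](addr0 0) -(mulr0 C).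
by apply: cvgD; apply: cvgMl_tmp; exact: cvg_harmonic.
Unshelve. all: by end_near. Qed.

End decay.

(** * Schwartz functions and their cosine and sine transforms *)

Section real_schwartz.
Context {R : realType}.
Local Notation mu := (@lebesgue_measure R).
Local Notation L1 f := (mu.-integrable setT (EFin \o f)).
Local Notation I f := (Rintegral mu setT f).
Implicit Types f g a b : R -> R.

(** The real and imaginary parts of a Schwartz function are exactly the functions
    of this kind (see [schwartz_components]). *)
Definition rschwartz a := smooth a /\
  forall k m, exists C : R, forall y, `|y ^+ k * derive1n m a y| <= C.

Lemma rschwartz_derive1 a : rschwartz a -> rschwartz (derive1 a).
Proof.
move=> [sa ba]; split; first exact: smooth_derive1.
move=> k m; have [C bC] := ba k m.+1; exists C => y.
by rewrite -derive1Sn.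
Qed.

Lemma rschwartzZ c a : rschwartz a -> rschwartz (fun x => c * a x).
Proof.
move=> [sa ba]; split; first exact: smoothZ.
move=> k m; have [C bC] := ba k m; exists (`|c| * C) => y.
by rewrite derive1nZ// mulrCA normrM ler_wpM2l.
Qed.

Lemma rschwartzN a : rschwartz a -> rschwartz (fun x => - a x).
Proof.
move=> sa; rewrite (_ : (fun x => _) = (fun x => (-1) * a x)).
  exact: rschwartzZ.
by apply/funext => x; rewrite mulN1r.
Qed.

Lemma rschwartzD a b : rschwartz a -> rschwartz b ->
  rschwartz (fun x => a x + b x).
Proof.
move=> [sa ba] [sb bb]; split; first exact: smoothD.
move=> k m; have [C bC] := ba k m; have [D bD] := bb k m; exists (C + D) => y.
by rewrite derive1nD// mulrDr (le_trans (ler_normD _ _))// lerD.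
Qed.

Lemma rschwartzB a b : rschwartz a -> rschwartz b ->
  rschwartz (fun x => a x - b x).
Proof. by move=> sa sb; apply: rschwartzD => //; exact: rschwartzN. Qed.

Lemma rschwartz_mulX a : rschwartz a -> rschwartz (fun x => x * a x).
Proof.
move=> [sa ba]; split; first exact: (smoothM smooth_id sa).
move=> k m; have [C bC] := ba k.+1 m; have [D bD] := ba k m.-1.
exists (C + m%:R * D) => y; rewrite derive1n_mulX// mulrDr.
rewrite (le_trans (ler_normD _ _))// lerD//.
  by rewrite mulrA -exprSr.
by rewrite mulrCA normrM ger0_norm// ler_wpM2l.
Qed.

Lemma rschwartz_continuous a : rschwartz a -> continuous a.
Proof. by case=> /smooth_continuous. Qed.

Lemma rschwartz_bounded a : rschwartz a -> exists C : R, forall x, `|a x| <= C.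
Proof.
by move=> [_ /(_ 0%N 0%N)[C bC]]; exists C => x; have := bC x; rewrite mul1r.
Qed.

(** The seminorms with [m = 0] and [k = 0, 2] bound [a] by a multiple of
    [(1 + |x|)^-2]. *)
Lemma rschwartz_L1 a : rschwartz a -> L1 a.
Proof.
move=> sa; have [_ ba] := sa.
have [C bC] := ba 0%N 0%N; have [D bD] := ba 2%N 0%N.
have h2 : 1 < 2 :> R by rewrite ltr1n.
apply: (L1_dominated _ (L1_scale (2 * (C + D)) (L1_decay h2))).
  exact: (continuous_measurable (rschwartz_continuous sa)).
move=> x; have p0 : 0 < 1 + `|x| by rewrite ltr_pwDl.
rewrite powRN powR_mulrn ?(ltW p0)// ler_pdivlMr ?exprn_gt0//.
apply: (le_trans (ler_wpM2l (normr_ge0 _) (onePsqr_le x))).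
have := bC x; have := bD x; rewrite /= !expr0 mul1r normrM normrX.
rewrite real_normK ?num_real//; move: `|a x| => u; nra.
Qed.

End real_schwartz.
Arguments rschwartz {R} a.

Section trigonometric_transforms.
Context {R : realType}.
Local Notation mu := (@lebesgue_measure R).
Local Notation L1 f := (mu.-integrable setT (EFin \o f)).
Local Notation I f := (Rintegral mu setT f).
Implicit Types f g a b : R -> R.

(** Up to the factor [(2 pi)^(-1/2)], the Fourier transform of [a + i b] is
    [(cosT a + sinT b) + i (cosT b - sinT a)]. *)
Definition cosT a : R -> R := fun x => I (fun y => cos (x * y) * a y).
Definition sinT a : R -> R := fun x => I (fun y => sin (x * y) * a y).

Lemma derivable_cos_mul (x y : R) : derivable (fun z : R => cos (z * y)) x 1 /\
  derive1 (fun z : R => cos (z * y)) x = - sin (x * y) * y.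
Proof.
have d := is_deriveM (is_derive_id x 1) (is_derive_cst (y : R) x 1).
have := @is_derive1_comp R cos (fun x => x * y) x _ _ (is_derive_cos (x * y)) d.
rewrite /GRing.scale/= mulr0 add0r mulr1 => -[dc e]; split=> //.
by rewrite derive1E e.
Qed.

Lemma derivable_sin_mul (x y : R) : derivable (fun z : R => sin (z * y)) x 1 /\
  derive1 (fun z : R => sin (z * y)) x = cos (x * y) * y.
Proof.
have d := is_deriveM (is_derive_id x 1) (is_derive_cst (y : R) x 1).
have := @is_derive1_comp R sin (fun x => x * y) x _ _ (is_derive_sin (x * y)) d.
rewrite /GRing.scale/= mulr0 add0r mulr1 => -[dc e]; split=> //.
by rewrite derive1E e.
Qed.

Lemma continuous_cos_mul (x : R) : continuous (fun y : R => cos (x * y)).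
Proof.
move=> y; apply: (@continuous_comp _ _ _ (fun y => x * y) cos).
  exact: mulrl_continuous.
exact: continuous_cos.
Qed.

Lemma continuous_sin_mul (x : R) : continuous (fun y : R => sin (x * y)).
Proof.
move=> y; apply: (@continuous_comp _ _ _ (fun y => x * y) sin).
  exact: mulrl_continuous.
exact: continuous_sin.
Qed.

Lemma L1_cos (x : R) a : L1 a -> L1 (fun y => cos (x * y) * a y).
Proof.
apply: (@L1_bounded_mul _ _ _ 1); last by move=> y; exact: cos_max.
exact: (continuous_measurable (@continuous_cos_mul x)).
Qed.

Lemma L1_sin (x : R) a : L1 a -> L1 (fun y => sin (x * y) * a y).
Proof.
apply: (@L1_bounded_mul _ _ _ 1); last by move=> y; exact: sin_max.
exact: (continuous_measurable (@continuous_sin_mul x)).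
Qed.

(** The domination is uniform in the parameter, so the local statement about
    differentiation under the integral applies around each point. *)
Lemma derive_under_I (K : R -> R -> R) (dK : R -> R -> R) (G : R -> R) (x : R) :
  (forall x, L1 (K x)) -> L1 G ->
  (forall x y, derivable ((K ^~ y) : R -> R) x 1 /\ derive1 ((K ^~ y) : R -> R) x = dK x y) ->
  (forall x y, `|dK x y| <= G y) ->
  derivable (fun z : R => I (K z)) x 1 /\
  derive1 (fun z : R => I (K z)) x = I (dK x).
Proof.
move=> jK jG HK bK.
have Ix : `]x - 1, x + 1[%classic x.
  by rewrite /= in_itv/= gtrBl ltrDl ltr01.
have d1 z y : `]x - 1, x + 1[%classic z -> setT y -> derivable ((K ^~ y) : R -> R) z 1.
  by move=> _ _; case: (HK z y).
have G0 y : 0 <= G y by exact: le_trans (bK 0 y).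
have ub z y : `]x - 1, x + 1[%classic z -> setT y ->
    `|partial1of2 K z y| <= G y.
  by move=> _ _; rewrite /partial1of2; case: (HK z y) => _ ->.
have jK' z : `]x - 1, x + 1[%classic z -> L1 (K z) by move=> _; exact: jK.
split.
  exact: (derivable_under_integral measurableT Ix jK' d1 G0 jG ub).
have := differentiation_under_integral measurableT Ix jK' d1 G0 jG ub.
move=> ->; congr Rintegral; apply/funext => y.
by rewrite /partial1of2; case: (HK x y).
Qed.

Lemma derive1_cosT a (x : R) : L1 a -> L1 (fun y => y * a y) ->
  derivable (cosT a) x 1 /\
  derive1 (cosT a) x = - sinT (fun y => y * a y) x.
Proof.
move=> ja jya.
have [||z y|z y|dc ->] := @derive_under_I (fun x y => cos (x * y) * a y)
  (fun x y => - (sin (x * y) * (y * a y))) (fun y => `|y * a y|) x.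
- by move=> z; exact: L1_cos.
- exact: L1_norm.
- have [d e] := derivable_cos_mul z y.
  have da : derivable (cst (a y) : R -> R) z 1 by exact: derivable_cst.
  split; first exact: (derivable_mul d da).
  rewrite (derive1_mul d da) e derive1_cst /= mulr0 addr0.
  by rewrite -mulrA mulNr.
- by rewrite normrN normrM ler_piMl// sin_max.
by split=> //; rewrite IN//; exact: L1_sin.
Qed.

Lemma derive1_sinT a (x : R) : L1 a -> L1 (fun y => y * a y) ->
  derivable (sinT a) x 1 /\ derive1 (sinT a) x = cosT (fun y => y * a y) x.
Proof.
move=> ja jya.
have [||z y|z y|dc ->] := @derive_under_I (fun x y => sin (x * y) * a y)
  (fun x y => cos (x * y) * (y * a y)) (fun y => `|y * a y|) x.
- by move=> z; exact: L1_sin.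
- exact: L1_norm.
- have [d e] := derivable_sin_mul z y.
  have da : derivable (cst (a y) : R -> R) z 1 by exact: derivable_cst.
  split; first exact: (derivable_mul d da).
  by rewrite (derive1_mul d da) e derive1_cst /= mulr0 addr0 -mulrA.
- by rewrite normrM ler_piMl// cos_max.
by split.
Qed.

Lemma derive1_cosE (x : R) : derive1 cos x = - sin x.
Proof. by rewrite derive1E; have [_ ->] := is_derive_cos x. Qed.

Lemma derive1_sinE (x : R) : derive1 sin x = cos x.
Proof. by rewrite derive1E; have [_ ->] := is_derive_sin x. Qed.

Lemma smooth_cos_sin : smooth (@cos R) /\ smooth (@sin R).
Proof.
suff h n : derivable_upto n (@cos R) /\ derivable_upto n (@sin R).
  by split; apply/smoothP => n; case: (h n).
elim: n => [|n [hc hs]].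
  split; (split; last by []) => t; first by have [] := is_derive_cos t.
  by have [] := is_derive_sin t.
split; split.
- by move=> t; have [] := is_derive_cos t.
- rewrite (_ : derive1 _ = (fun x => (-1) * sin x)).
    by apply: derivable_uptoM => //; exact: derivable_upto_cst.
  by apply/funext => x; rewrite derive1_cosE mulN1r.
- by move=> t; have [] := is_derive_sin t.
- by rewrite (_ : derive1 _ = cos)//; apply/funext => x; rewrite derive1_sinE.
Qed.

Lemma smooth_mulx (x : R) : smooth (fun y => x * y).
Proof. by apply: smoothZ; exact: smooth_id. Qed.

Lemma derive1_cos_mull (x y : R) :
  derive1 (fun z : R => cos (x * z)) y = - sin (x * y) * x.
Proof.
rewrite (_ : (fun z => _) = (fun z => cos (z * x))); last first.
  by apply/funext => z; rewrite mulrC.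
by have [_ ->] := derivable_cos_mul y x; rewrite (mulrC y).
Qed.

Lemma derive1_sin_mull (x y : R) :
  derive1 (fun z : R => sin (x * z)) y = cos (x * y) * x.
Proof.
rewrite (_ : (fun z => _) = (fun z => sin (z * x))); last first.
  by apply/funext => z; rewrite mulrC.
by have [_ ->] := derivable_sin_mul y x; rewrite (mulrC y).
Qed.

(** The derivative of [sin (x * y) * a y] in [y] has integral zero. *)
Lemma mulX_cosT a (x : R) : rschwartz a -> x * cosT a x = - sinT (derive1 a) x.
Proof.
move=> sa; have [sma ba] := sa.
have ja := rschwartz_L1 sa; have ja' := rschwartz_L1 (rschwartz_derive1 sa).
have ss : smooth (fun y => sin (x * y)).
  by apply: smooth_comp; [exact: smooth_cos_sin.2|exact: smooth_mulx].
have dE : derive1 (fun y => sin (x * y) * a y) =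
    (fun y => x * (cos (x * y) * a y) + sin (x * y) * derive1 a y).
  apply/funext => y; rewrite (derive1_mul (ss 0%N y) (sma 0%N y)).
  by rewrite derive1_sin_mull (mulrC _ x) -mulrA.
have [C bC] := ba 1%N 0%N.
have j1 : L1 (fun y => x * (cos (x * y) * a y)) by exact/L1_scale/L1_cos.
have j2 : L1 (fun y => sin (x * y) * derive1 a y) by exact: L1_sin.
have := @I_derive1_eq0 R (fun y => sin (x * y) * a y) C.
rewrite dE ID// IZ; last exact: L1_cos.
move=> /(_ (smoothM ss sma)) => h; apply/eqP; rewrite -addr_eq0; apply/eqP.
apply: h; last exact: L1_add.
move=> y; apply: le_trans (bC y); rewrite /= expr1 mulrCA normrM.
by rewrite ler_piMl// sin_max.
Qed.

(** The derivative of [cos (x * y) * a y] in [y] has integral zero. *)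
Lemma mulX_sinT a (x : R) : rschwartz a -> x * sinT a x = cosT (derive1 a) x.
Proof.
move=> sa; have [sma ba] := sa.
have ja := rschwartz_L1 sa; have ja' := rschwartz_L1 (rschwartz_derive1 sa).
have ss : smooth (fun y => cos (x * y)).
  by apply: smooth_comp; [exact: smooth_cos_sin.1|exact: smooth_mulx].
have dE : derive1 (fun y => cos (x * y) * a y) =
    (fun y => (- x) * (sin (x * y) * a y) + cos (x * y) * derive1 a y).
  apply/funext => y; rewrite (derive1_mul (ss 0%N y) (sma 0%N y)).
  by rewrite derive1_cos_mull mulNr (mulrC _ x) -mulNr -mulrA.
have [C bC] := ba 1%N 0%N.
have j1 : L1 (fun y => - x * (sin (x * y) * a y)) by exact/L1_scale/L1_sin.
have j2 : L1 (fun y => cos (x * y) * derive1 a y) by exact: L1_cos.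
have := @I_derive1_eq0 R (fun y => cos (x * y) * a y) C.
rewrite dE ID// IZ; last exact: L1_sin.
move=> /(_ (smoothM ss sma)) => h; apply/eqP; rewrite eq_sym -subr_eq0.
rewrite addrC -mulNr; apply/eqP; apply: h; last exact: L1_add.
move=> y; apply: le_trans (bC y); rewrite /= expr1 mulrCA normrM.
by rewrite ler_piMl// cos_max.
Qed.

(** Both transforms must be treated together, as differentiation and
    multiplication by the variable exchange them; this class is stable under
    these two operations and its elements are bounded. *)
Definition trig_transform f :=
  exists2 b, rschwartz b & f = cosT b \/ f = sinT b.

Lemma trig_transform_derive1 f : trig_transform f ->
  (forall x, derivable f x 1) /\ trig_transform (derive1 f).
Proof.
move=> [b sb fE]; have sxb := rschwartz_mulX sb.
have [jb jxb] := (rschwartz_L1 sb, rschwartz_L1 sxb).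
case: fE => ->.
  split; first by move=> x; have [] := derive1_cosT x jb jxb.
  exists (fun y => - (y * b y)); [exact: rschwartzN|right].
  apply/funext => x; have [_ ->] := derive1_cosT x jb jxb.
  rewrite /sinT -IN; last exact: L1_sin.
  by congr Rintegral; apply/funext => y; rewrite mulrN.
split; first by move=> x; have [] := derive1_sinT x jb jxb.
exists (fun y => y * b y) => //; left.
by apply/funext => x; have [_ ->] := derive1_sinT x jb jxb.
Qed.

Lemma trig_transform_mulX f : trig_transform f ->
  trig_transform (fun x => x * f x).
Proof.
move=> [b sb fE]; have sb' := rschwartz_derive1 sb.
case: fE => ->.
  exists (fun y => - derive1 b y); [exact: rschwartzN|right].
  apply/funext => x; rewrite mulX_cosT// /sinT -IN; last first.
    exact: (L1_sin x (rschwartz_L1 sb')).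
  by congr Rintegral; apply/funext => y; rewrite mulrN.
by exists (derive1 b) => //; left; apply/funext => x; rewrite mulX_sinT.
Qed.

Lemma cosT_bounded a x : L1 a -> `|cosT a x| <= I (fun y => `|a y|).
Proof.
move=> ja; apply: I_norm_le; last 1 first.
- by move=> y; rewrite normrM ler_piMl// cos_max.
- exact: (L1_measurable (L1_cos x ja)).
- exact: L1_norm.
Qed.

Lemma sinT_bounded a x : L1 a -> `|sinT a x| <= I (fun y => `|a y|).
Proof.
move=> ja; apply: I_norm_le; last 1 first.
- by move=> y; rewrite normrM ler_piMl// sin_max.
- exact: (L1_measurable (L1_sin x ja)).
- exact: L1_norm.
Qed.

Lemma trig_transform_rschwartz f : trig_transform f -> rschwartz f.
Proof.
have dn n g : trig_transform g -> trig_transform (derive1n n g).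
  elim: n g => [//|n IH] g /trig_transform_derive1[_ /IH].
  by rewrite derive1Sn.
move=> tf; split=> [n x|k m].
  by have [] := trig_transform_derive1 (dn n f tf).
have : trig_transform (fun y => y ^+ k * derive1n m f y).
  elim: k => [|k IH].
    rewrite (_ : (fun y => _) = derive1n m f); first exact: dn.
    by apply/funext => y; rewrite mul1r.
  rewrite (_ : (fun y => _) = (fun y => y * (y ^+ k * derive1n m f y))).
    exact: trig_transform_mulX.
  by apply/funext => y; rewrite exprS mulrA.
move=> [b sb fE]; exists (I (fun y => `|b y|)) => y.
have jb := rschwartz_L1 sb.
by case: fE => /(congr1 (@^~ y)) ->; [exact: cosT_bounded|exact: sinT_bounded].
Qed.

Lemma rschwartz_cosT a : rschwartz a -> rschwartz (cosT a).
Proof. by move=> sa; apply: trig_transform_rschwartz; exists a => //; left. Qed.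

Lemma rschwartz_sinT a : rschwartz a -> rschwartz (sinT a).
Proof. by move=> sa; apply: trig_transform_rschwartz; exists a => //; right. Qed.

End trigonometric_transforms.

(** * Gaussian functions *)

Section gaussian.
Context {R : realType}.
Local Notation mu := (@lebesgue_measure R).
Local Notation L1 f := (mu.-integrable setT (EFin \o f)).
Local Notation I f := (Rintegral mu setT f).
Local Notation G := (@gauss_fun R).
Implicit Types f g a b : R -> R.

Lemma derive1_gauss (x : R) :
  derivable G x 1 /\ derive1 G x = (-2) * (x * G x).
Proof.
have d1 := is_deriveM (is_derive_id x 1) (is_derive_id x 1).
have d2 := is_deriveN d1.
have := @is_derive1_comp R expR (fun x => - (x * x)) x _ _
  (is_derive_expR _) d2.
rewrite /GRing.scale/= mulr1 => -[d3 e]; rewrite /gauss_fun.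
rewrite (_ : (fun x => _) = (fun x => expR (- (x * x)))); last first.
  by apply/funext => y; rewrite expr2.
by split=> //; rewrite derive1E e expr2; ring.
Qed.

Lemma smooth_gauss : smooth G.
Proof.
apply/smoothP => n; elim: n => [|n IH].
  by split; last by []; move=> t; case: (derive1_gauss t).
split; first by move=> t; case: (derive1_gauss t).
rewrite (_ : derive1 _ = (fun x => (-2) * (x * G x))); last first.
  by apply/funext => x; case: (derive1_gauss x).
apply: derivable_uptoM; first exact: derivable_upto_cst.
by apply: derivable_uptoM => //; exact: (smoothP _).1 smooth_id n.
Qed.

(** One term of the exponential series of [expR (y ^+ 2)] dominates [y ^+ k]. *)
Lemma gauss_monomial_bounded (k : nat) :
  exists C : R, forall y, `|y ^+ k * G y| <= C.
Proof.
exists (1 + k.+1`!%:R) => y; rewrite normrM (ger0_norm (gauss_fun_ge0 _)).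
have e1 := @expR_ge1Dxn R (y ^+ 2) k (sqr_ge0 y).
have e0 : 0 < expR (y ^+ 2) by exact: expR_gt0.
rewrite /gauss_fun expRN ler_pdivrMr// normrX.
have f0 : 0 < k.+1`!%:R :> R by rewrite ltr0n fact_gt0.
have yk : `|y| ^+ k <= 1 + (y ^+ 2) ^+ k.+1.
  rewrite -[y ^+ 2]real_normK ?num_real// -exprM.
  have [y1|y1] := leP `|y| 1.
    by rewrite ler_wpDr ?exprn_ge0// exprn_ile1.
  by rewrite ler_wpDl// ler_weXn2l ?(ltW y1)//; lia.
apply: (le_trans yk); move: e1 e0 f0.
set u := (y ^+ 2) ^+ k.+1; set E := expR _; set f := k.+1`!%:R.
move=> e1 e0 f0.
have u0 : 0 <= u by rewrite exprn_ge0// sqr_ge0.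
have : u / f <= E by rewrite (le_trans _ e1)// lerDr.
rewrite ler_pdivrMr// => h1.
have : 1 <= E by rewrite (le_trans _ e1)// lerDl divr_ge0// ltW.
nra.
Qed.

(** Up to sign, [p] is the Hermite polynomial of degree [m], built by its
    recursion. *)
Lemma derive1n_gauss (m : nat) :
  exists p : {poly R}, forall y, derive1n m G y = p.[y] * G y.
Proof.
elim: m => [|m [p pE]]; first by exists 1 => y; rewrite hornerC mul1r.
exists (p^`() - 2 *: ('X * p)) => y; rewrite derive1nS.
rewrite (_ : derive1n m G = (fun y => p.[y] * G y)); last exact/funext.
have [dG eG] := derive1_gauss y.
have dp : derivable (fun x : R => p.[x]) y 1 by exact: derivable_horner.
rewrite (derive1_mul dp dG) eG -derivE.
by rewrite hornerD hornerN hornerZ hornerM hornerX; ring.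
Qed.

Lemma gauss_poly_bounded (p : {poly R}) :
  exists C : R, forall y, `|p.[y] * G y| <= C.
Proof.
have /choice[C bC] := gauss_monomial_bounded.
exists (\sum_(i < size p) `|p`_i| * C i) => y.
rewrite horner_coef mulr_suml (le_trans (ler_norm_sum _ _ _))//.
apply: ler_sum => i _; rewrite -mulrA normrM ler_wpM2l//; exact: bC.
Qed.

Lemma rschwartz_gauss : rschwartz G.
Proof.
split; first exact: smooth_gauss.
move=> k m; have [p pE] := derive1n_gauss m.
have [C bC] := gauss_poly_bounded ('X^k * p); exists C => y.
by rewrite pE mulrA; have := bC y; rewrite hornerM hornerXn.
Qed.

Lemma derive1n_affine a (e x : R) m : smooth a ->
  derive1n m (fun y => a (e * y + x)) = 
  (fun y => e ^+ m * derive1n m a (e * y + x)).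
Proof.
move=> sa; elim: m => [|m IH].
  by apply/funext => y; rewrite mul1r.
rewrite derive1nS IH; apply/funext => y.
have s1 : smooth (fun y => e * y + x).
  by apply: smoothD; [exact: smooth_mulx|exact: smooth_cst].
have d1 : derive1 (fun y => e * y + x) y = e.
  rewrite derive1E.
  have := is_deriveD (is_deriveM (is_derive_cst e y 1) (is_derive_id y 1))
    (is_derive_cst x y 1).
  by rewrite /GRing.scale/= mulr0 addr0 mulr1 addr0 => -[_ ->].
have s2 : smooth (fun y => derive1n m a (e * y + x)).
  exact: (@smooth_comp _ _ (fun y => e * y + x) (@smooth_derive1n _ m a sa) s1).
rewrite (derive1_mul (@derivable_cstfun _ (e ^+ m) y) (s2 0%N y)).
rewrite derive1_cst mul0r add0r exprSr -mulrA; congr (_ * _).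
rewrite derive1nS -[X in _ = X * _]d1 mulrC.
exact: (@derive1_comp _ (fun y => e * y + x) (derive1n m a) y (s1 0%N y)
  (@smooth_derive1n _ m a sa 0%N _)).
Qed.

(** Powers of [y] are traded one by one for powers of [u = e * y + x], using
    [y = (u - x) / e] and the stability of Schwartz functions under
    multiplication by [u - x]. *)
Lemma rschwartz_affine a (e x : R) : e != 0 -> rschwartz a ->
  rschwartz (fun y => a (e * y + x)).
Proof.
move=> e0 sa; have [sma _] := sa.
have bnd k b : rschwartz b -> exists C : R, forall y, `|y ^+ k * b (e * y + x)| <= C.
  elim: k b => [|k IH] b sb.
    by have [C bC] := rschwartz_bounded sb; exists C => y; rewrite mul1r.
  have sb1 : rschwartz (fun u => e^-1 * (u * b u - x * b u)).
    by apply/rschwartzZ/rschwartzB; [exact: rschwartz_mulX|exact: rschwartzZ].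
  have [C bC] := IH _ sb1; exists C => y.
  rewrite (_ : _ * _ = y ^+ k *
    (e^-1 * ((e * y + x) * b (e * y + x) - x * b (e * y + x)))); first exact: bC.
  by rewrite -mulrBl addrK -(mulrA e) mulKf// exprSr -mulrA.
split.
  apply: (@smooth_comp _ a (fun y => e * y + x) sma).
  by apply: smoothD; [exact: smooth_mulx|exact: smooth_cst].
move=> k m; rewrite derive1n_affine//.
have sm : rschwartz (fun u => e ^+ m * derive1n m a u).
  apply: rschwartzZ; elim: m => [//|m IH]; rewrite derive1nS.
  exact: rschwartz_derive1.
exact: bnd sm.
Qed.

(** The product of [f] with the integrating factor [expR (x ^+ 2 / 4)] has
    derivative zero. *)
Lemma gauss_ode f : (forall x, derivable f x 1) ->
  (forall x, derive1 f x = - (x / 2) * f x) ->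
  forall x, f x = f 0 * G (x / 2).
Proof.
move=> df fE x.
have dE (z : R) : is_derive z 1 (fun z : R => expR (z ^+ 2 / 4))
    (expR (z ^+ 2 / 4) * (z / 2)).
  have d1 := is_deriveM (is_derive_id z 1) (is_derive_id z 1).
  have d2 := is_deriveM d1 (is_derive_cst (4^-1 : R) z 1).
  have := @is_derive1_comp R expR (fun x => x * x * 4^-1) z _ _
    (is_derive_expR _) d2.
  rewrite /GRing.scale/= mulr0 add0r mulr1 -expr2.
  rewrite (_ : 4^-1 * (z + z) = z / 2) //; by field.
have cst (y : R) : is_derive y 1 (fun z : R => f z * expR (z ^+ 2 / 4)) 0.
  have [d1 e1] := dE y.
  split; first exact: (derivable_mul (df y) d1).
  rewrite -derive1E (derive1_mul (df y) d1) fE derive1E e1; ring.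
have := is_derive_0_is_cst x 0 cst.
rewrite expr0n/= mul0r expR0 mulr1 => <-.
rewrite -mulrA /gauss_fun -expRD exprMn.
rewrite (_ : x ^+ 2 / 4 + - _ = 0) ?expR0 ?mulr1//; by field.
Qed.

Lemma I_gauss : I G = Num.sqrt pi.
Proof. by rewrite /Rintegral integralT_gauss. Qed.

Let sG := rschwartz_gauss.

Lemma derive1_gaussE : derive1 G = (fun x => (-2) * (x * G x)).
Proof. by apply/funext => x; case: (derive1_gauss x). Qed.

(** Since [G' = - 2 x G], the rules exchanging derivatives and multiplications
    turn the equation of the Gaussian into the equation [f' = - (x / 2) f] for
    its transform; the value at [0] is the Gaussian integral. *)
Lemma cosT_gauss (x : R) : cosT G x = Num.sqrt pi * G (x / 2).
Proof.
have jG := rschwartz_L1 sG; have jxG := rschwartz_L1 (rschwartz_mulX sG).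
rewrite (@gauss_ode (cosT G)).
- by congr (_ * _); rewrite -I_gauss; congr Rintegral; apply/funext => y;
    rewrite mul0r cos0 mul1r.
- by move=> y; case: (derive1_cosT y jG jxG).
move=> y; have [_ ->] := derive1_cosT y jG jxG.
have := mulX_cosT y sG; rewrite derive1_gaussE => h.
have e : sinT (fun x => -2 * (x * G x)) y = - 2 * sinT (fun x => x * G x) y.
  rewrite /sinT -IZ; last exact: L1_sin.
  by congr Rintegral; apply/funext => z; rewrite mulrCA.
have -> : - (y / 2) * cosT G y = - (2^-1) * (y * cosT G y) by ring.
rewrite h e; by field.
Qed.

(** The sine transform solves the same equation, with value [0] at [0]. *)
Lemma sinT_gauss (x : R) : sinT G x = 0.
Proof.
have jG := rschwartz_L1 sG; have jxG := rschwartz_L1 (rschwartz_mulX sG).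
rewrite (@gauss_ode (sinT G)).
- rewrite (_ : sinT G 0 = 0) ?mul0r// /sinT.
  rewrite (_ : (fun y => _) = (fun y => 0 * G y)); last first.
    by apply/funext => y; rewrite mul0r sin0.
  by rewrite IZ// mul0r.
- by move=> y; case: (derive1_sinT y jG jxG).
move=> y; have [_ ->] := derive1_sinT y jG jxG.
have := mulX_sinT y sG; rewrite derive1_gaussE => h.
have e : cosT (fun x => -2 * (x * G x)) y = - 2 * cosT (fun x => x * G x) y.
  rewrite /cosT -IZ; last exact: L1_cos.
  by congr Rintegral; apply/funext => z; rewrite mulrCA.
have -> : - (y / 2) * sinT G y = - (2^-1) * (y * sinT G y) by ring.
rewrite h e; by field.
Qed.

Lemma I_affine f (e x : R) : 0 < e -> continuous f -> L1 f ->
  I f = e * I (fun y => f (e * y + x)) /\ L1 (fun y => f (e * y + x)).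
Proof.
move=> e0 cf jf.
have incr : {homo (fun y => e * y + x) : u v / u < v}.
  by move=> u v uv; rewrite ltrD2r ltr_pM2l.
have s1 : smooth (fun y => e * y + x).
  by apply: smoothD; [exact: smooth_mulx|exact: smooth_cst].
have d1 y : derive1 (fun y => e * y + x) y = e.
  have := @derive1n_affine (fun y => y) e x 1 smooth_id.
  by rewrite /= => /(congr1 (@^~ y)) ->; rewrite derive1_id mulr1.
have VK : cancel (fun z => (z - x) / e) (fun y => e * y + x).
  by move=> z; rewrite mulrC divfK ?gt_eqF// subrK.
have [j1 E1] := change_of_variables incr VK s1 cf jf.
have jfe : L1 (fun y => f (e * y + x)).
  have := L1_scale e^-1 j1; congr (_.-integrable _ _); apply/funext => y /=.
  by rewrite d1 mulrCA mulVf ?mulr1// gt_eqF.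
split=> //; rewrite -E1 -IZ//; congr Rintegral; apply/funext => y.
by rewrite d1 mulrC.
Qed.

Lemma cosT_gauss_scale (e x : R) : 0 < e ->
  cosT (fun y => G (e * y)) x = Num.sqrt pi / e * G (x / e / 2).
Proof.
move=> e0.
have jc := L1_cos (x / e) (rschwartz_L1 sG).
have cc : continuous (fun y => cos (x / e * y) * G y).
  move=> y; apply: cvgM; first exact: continuous_cos_mul.
  exact: rschwartz_continuous.
have [+ _] := I_affine 0 e0 cc jc.
rewrite -/(cosT G (x / e)) cosT_gauss => /esym/(canRL (mulKf (lt0r_neq0 e0))) h.
transitivity (e^-1 * (Num.sqrt pi * G (x / e / 2))); last by ring.
rewrite -h; congr Rintegral.
by apply/funext => y; rewrite addr0 mulrA divfK// gt_eqF.
Qed.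

Lemma sinT_gauss_scale (e x : R) : 0 < e -> sinT (fun y => G (e * y)) x = 0.
Proof.
move=> e0.
have jc := L1_sin (x / e) (rschwartz_L1 sG).
have cc : continuous (fun y => sin (x / e * y) * G y).
  move=> y; apply: cvgM; first exact: continuous_sin_mul.
  exact: rschwartz_continuous.
have [+ _] := I_affine 0 e0 cc jc.
rewrite -/(sinT G (x / e)) sinT_gauss => /esym/eqP.
rewrite mulf_eq0 gt_eqF//= => /eqP h; rewrite -[RHS]h; congr Rintegral.
by apply/funext => y; rewrite addr0 mulrA divfK// gt_eqF.
Qed.

(** After rescaling, convolution with a narrow Gaussian has this form, and
    dominated convergence applies because [f] is continuous and bounded. *)
Lemma gauss_approximation f (C x : R) (e : nat -> R) :
  continuous f -> (forall y, `|f y| <= C) -> e n @[n --> \oo] --> (0 : R) ->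
  I (fun z => f (e n * z + x) * G z) @[n --> \oo] --> Num.sqrt pi * f x.
Proof.
move=> cf fC e0.
have cG : continuous G by exact: rschwartz_continuous.
have ca n : continuous (fun z => e n * z + x).
  by move=> z; apply: cvgD; [exact: mulrl_continuous|exact: cvg_cst].
have cfa n : continuous (fun z => f (e n * z + x)).
  by move=> z; apply: continuous_comp; [exact: ca|exact: cf].
have cfG n : continuous (fun z => f (e n * z + x) * G z).
  by move=> z; apply: cvgM; [exact: cfa|exact: cG].
have := @I_dominated_cvg R (fun n z => f (e n * z + x) * G z)
  (fun z => f x * G z) (fun z => C * G z).
case.
- by move=> n; exact: (continuous_measurable (cfG n)).
- move=> z; apply: cvgM; last exact: cvg_cst.
  apply: (@continuous_cvg _ _ _ _ _ (fun n => e n * z + x) f x); first exact: cf.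
  rewrite -[X in _ --> X]add0r -(mul0r z); apply: cvgD; last exact: cvg_cst.
  by apply: cvgM; [exact: e0|exact: cvg_cst].
- exact: L1_scale (rschwartz_L1 sG).
- move=> n z; rewrite normrM (ger0_norm (gauss_fun_ge0 _)) ler_wpM2r//.
  exact: gauss_fun_ge0.
move=> _; rewrite IZ ?I_gauss 1?mulrC//; exact: rschwartz_L1.
Qed.

End gaussian.

(** * Exchanging a transform between two integrable functions *)

Section inversion.
Context {R : realType}.
Local Notation mu := (@lebesgue_measure R).
Local Notation L1 f := (mu.-integrable setT (EFin \o f)).
Local Notation I f := (Rintegral mu setT f).
Local Notation G := (@gauss_fun R).
Implicit Types f g a b p q : R -> R.

(** The double integral converges absolutely, being dominated by [|a| |p|], so
    this is Fubini's theorem. *)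
Lemma I_kernel_exchange (k : R -> R) a p :
  continuous k -> (forall x, `|k x| <= 1) -> L1 a -> L1 p ->
  I (fun x => I (fun y => k (x * y) * a y) * p x) =
  I (fun y => a y * I (fun x => k (y * x) * p x)).
Proof.
move=> ck k1 ja jp.
have [ma mp] := (L1_measurable ja, L1_measurable jp).
pose F (z : measurableTypeR R * measurableTypeR R) : \bar R :=
  (k (z.1 * z.2) * a z.2 * p z.1)%:E.
have mk : measurable_fun setT k := continuous_measurable ck.
have mF : measurable_fun setT F.
  apply/measurable_EFinP; apply: measurable_funM; last first.
    exact: (measurableT_comp mp measurable_fst).
  apply: measurable_funM; last first.
    exact: (measurableT_comp ma measurable_snd).
  apply: (measurableT_comp mk).
  by apply: measurable_funM; [exact: measurable_fst|exact: measurable_snd].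
have mkm x : measurable_fun setT (fun y : R => k (x * y)).
  by apply: (measurableT_comp mk); exact: measurable_funM.
have jka x : L1 (fun y => k (x * y) * a y).
  by apply: (@L1_bounded_mul _ _ _ 1).
have jkp y : L1 (fun x => k (y * x) * p x).
  by apply: (@L1_bounded_mul _ _ _ 1).
have jkap x : L1 (fun y => k (x * y) * a y * p x).
  have := L1_scale (p x) (jka x); congr (_.-integrable _ _).
  by apply/funext => y /=; rewrite mulrC.
have jF : (mu \x mu)%E.-integrable setT F.
  apply/integrable12ltyP => //.
  have [_ ja1] := integrableP _ _ _ (L1_norm ja).
  have jc := L1_scale (I (fun y => `|a y|)) (L1_norm jp).
  have [_ jp1] := integrableP _ _ _ jc.
  apply: le_lt_trans jp1; apply: ge0_le_integral => //=.
  - by move=> x _; exact: integral_ge0.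
  - apply: (measurable_fun_fubini_tonelli_F (m2 := mu) (abse \o F)); last by move=> z; exact: abse_ge0.
    exact: (measurableT_comp (@abse_measurable R setT) mF).
  - exact: (measurable_int _ (L1_norm jc)).
  move=> x _.
  have -> : (\int[mu]_y (`|k (x * y) * a y * p x|)%:E)%E =
      (I (fun y => `|k (x * y) * a y * p x|))%:E.
    by rewrite /Rintegral fineK//; exact: (integrable_fin_num measurableT (L1_norm (jkap x))).
  rewrite lee_fin [leRHS]ger0_norm; last first.
    by rewrite mulr_ge0//; apply: Rintegral_ge0.
  rewrite -RintegralZr//; last exact: L1_norm.
  apply: le_Rintegral => //.
  - exact: L1_norm.
  - have := L1_scale `|p x| (L1_norm ja); congr (_.-integrable _ _).
    by apply/funext => y /=; rewrite mulrC.
  - by move=> y _; rewrite normrM ler_wpM2r// normrM ler_piMl.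
have := Fubini jF; rewrite /F/= => E.
rewrite /Rintegral; congr fine; transitivity (\int[mu]_x \int[mu]_y
    (k (x * y) * a y * p x)%:E)%E.
  apply: eq_integral => x _.
  rewrite mulrC -/(I (fun y => k (x * y) * a y)) -IZ//.
  rewrite -[RHS]fineK; last exact: (integrable_fin_num measurableT (jkap x)).
  congr (_%:E); congr fine; apply: eq_integral => y _; by rewrite mulrC.
rewrite E; apply: eq_integral => y _.
rewrite -/(I (fun x => k (y * x) * p x)) -IZ// -[LHS]fineK.
  congr (_%:E); congr fine; apply: eq_integral => x _.
  by rewrite (mulrC x) mulrCA mulrA.
have := L1_scale (a y) (jkp y) => /(integrable_fin_num measurableT).
congr (_ \is a fin_num); apply: eq_integral => x _ /=.
by rewrite (mulrC x) mulrCA mulrA.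
Qed.

Lemma L1_mul_bounded f g C : measurable_fun setT g -> (forall x, `|g x| <= C) ->
  L1 f -> L1 (fun x => f x * g x).
Proof.
move=> mg gC jf; have := L1_bounded_mul mg gC jf.
by congr (_.-integrable _ _); apply/funext => x /=; rewrite mulrC.
Qed.

Lemma continuous_I_kernel (k : R -> R) a : continuous k -> 
  (forall x, `|k x| <= 1) -> L1 a -> 
  continuous (fun x : R => I (fun y => k (x * y) * a y)).
Proof.
move=> ck k1 ja x.
have mkm z : measurable_fun setT (fun y : R => k (z * y)).
  by apply: (measurableT_comp (continuous_measurable ck)); exact: measurable_funM.
have cka (y : R) : continuous (fun z : R => k (z * y) * a y).
  have ckm : continuous (fun z : R => k (z * y)).
    move=> z; apply: (@continuous_comp _ _ _ (fun z : R => z * y) k); last exact: ck.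
    exact: mulrr_continuous.
  by move=> z; apply: cvgM; [exact: ckm|exact: cvg_cst].
have Ix : x \in `]x - 1, x + 1[%classic.
  by rewrite inE/= in_itv/= gtrBl ltrDl ltr01.
apply: (@continuity_under_integral R _ _ mu (fun x y => k (x * y) * a y) setT
  measurableT (x - 1) (x + 1) _ _ (fun y => `|a y|)) => //.
- move=> z _; apply: (@L1_bounded_mul _ _ _ 1) => //.
- by apply: nearW => y _ z _; exact: cka.
- exact: L1_norm.
- by move=> z _; apply: nearW => y _; rewrite normrM ler_piMl.
Qed.

Lemma continuous_cosT a : L1 a -> continuous (cosT a).
Proof.
by apply: continuous_I_kernel; [exact: continuous_cos|exact: cos_max].
Qed.

Lemma continuous_sinT a : L1 a -> continuous (sinT a).
Proof.
by apply: continuous_I_kernel; [exact: continuous_sin|exact: sin_max].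
Qed.

Lemma cosT_exchange a p : L1 a -> L1 p ->
  I (fun x => cosT a x * p x) = I (fun y => a y * cosT p y).
Proof.
by apply: I_kernel_exchange; [exact: continuous_cos|exact: cos_max].
Qed.

Lemma sinT_exchange a p : L1 a -> L1 p ->
  I (fun x => sinT a x * p x) = I (fun y => a y * sinT p y).
Proof.
by apply: I_kernel_exchange; [exact: continuous_sin|exact: sin_max].
Qed.

Lemma L1_mul_cosT f a : L1 f -> L1 a -> L1 (fun x => f x * cosT a x).
Proof.
move=> jf ja; apply: (@L1_mul_bounded f (cosT a) (I (fun y => `|a y|))) => //.
  exact: (continuous_measurable (continuous_cosT ja)).
by move=> x; exact: cosT_bounded.
Qed.

Lemma L1_mul_sinT f a : L1 f -> L1 a -> L1 (fun x => f x * sinT a x).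
Proof.
move=> jf ja; apply: (@L1_mul_bounded f (sinT a) (I (fun y => `|a y|))) => //.
  exact: (continuous_measurable (continuous_sinT ja)).
by move=> x; exact: sinT_bounded.
Qed.

End inversion.

(** * Gaussian windows and the inversion formulas *)

Section gaussian_window.
Context {R : realType}.
Local Notation mu := (@lebesgue_measure R).
Local Notation L1 f := (mu.-integrable setT (EFin \o f)).
Local Notation I f := (Rintegral mu setT f).
Local Notation G := (@gauss_fun R).
Implicit Types f g a b : R -> R.

Lemma rschwartz_gauss_window (e x : R) : 0 < e ->
  rschwartz (fun y => G ((y - x) / e)).
Proof.
move=> e0; rewrite (_ : (fun y => _) = (fun y => G (e^-1 * y + - x / e))).
  by apply: rschwartz_affine (rschwartz_gauss); rewrite invr_neq0// gt_eqF.
by apply/funext => y; congr G; ring.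
Qed.

(** The substitution [y = e * z + x]. *)
Lemma I_gauss_window f (C e x : R) : 0 < e -> continuous f ->
  (forall y, `|f y| <= C) ->
  I (fun y => f y * G ((y - x) / e)) = e * I (fun z => f (e * z + x) * G z).
Proof.
move=> e0 cf fC.
have sw := rschwartz_gauss_window x e0.
have cw := rschwartz_continuous sw.
have j : L1 (fun y => f y * G ((y - x) / e)).
  apply: (@L1_bounded_mul _ _ _ C) => //; last exact: rschwartz_L1.
  exact: (continuous_measurable cf).
have c : continuous (fun y => f y * G ((y - x) / e)).
  by move=> y; apply: cvgM; [exact: cf|exact: cw].
have [-> _] := I_affine x e0 c j; congr (_ * _); congr Rintegral.
by apply/funext => z; rewrite addrK (mulrC e) mulfK// gt_eqF.
Qed.

(** Testing against ever narrower Gaussian windows around [x] gives [f x]. *)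
Lemma eq0_of_schwartz_orthogonal f (C : R) : continuous f ->
  (forall y, `|f y| <= C) ->
  (forall g, rschwartz g -> I (fun y => f y * g y) = 0) -> forall x, f x = 0.
Proof.
move=> cf fC h x.
have cv := @gauss_approximation R f C x _ cf fC (@cvg_harmonic R).
have E n : I (fun z => f (harmonic n * z + x) * G z) = 0.
  have e0 : 0 < harmonic n :> R by rewrite /harmonic/= invr_gt0.
  have := h _ (rschwartz_gauss_window x e0).
  rewrite (I_gauss_window _ e0 cf fC) => /eqP.
  by rewrite mulf_eq0 gt_eqF//= => /eqP.
move: cv; under eq_fun do rewrite E; move=> cv.
have cz : (0 : R) @[_ --> \oo] --> (0 : R) by exact: cvg_cst.
have /eqP : Num.sqrt pi * f x = 0 by exact: (cvg_unique _ cv cz).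
by rewrite mulf_eq0 sqrtr_eq0 leNgt pi_gt0//= => /eqP.
Qed.

End gaussian_window.

Section trigonometric_inversion.
Context {R : realType}.
Local Notation mu := (@lebesgue_measure R).
Local Notation L1 f := (mu.-integrable setT (EFin \o f)).
Local Notation I f := (Rintegral mu setT f).
Local Notation G := (@gauss_fun R).
Local Notation Ge n := (fun y : R => G (harmonic n * y)).
Variables (a : R -> R) (x : R).
Hypothesis sa : rschwartz a.

Let ja : L1 a := rschwartz_L1 sa.
Let jca : L1 (cosT a) := rschwartz_L1 (rschwartz_cosT sa).
Let jsa : L1 (sinT a) := rschwartz_L1 (rschwartz_sinT sa).

Let e0 n : 0 < harmonic n :> R.
Proof. by rewrite /harmonic/= invr_gt0. Qed.

Let sGe n : rschwartz (Ge n).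
Proof.
have := rschwartz_affine 0 (lt0r_neq0 (e0 n)) rschwartz_gauss.
by congr rschwartz; apply/funext => y; rewrite addr0.
Qed.

Let cGe n : continuous (Ge n) := rschwartz_continuous (sGe n).

Let jGe n : L1 (Ge n) := rschwartz_L1 (sGe n).

(** A Gaussian cut-off in the frequency variable restores the function in the
    limit, by dominated convergence. *)
Let cutoff_cvg f : L1 f ->
  I (fun y => f y * Ge n y) @[n --> \oo] --> I f.
Proof.
move=> jf.
have [] // := @I_dominated_cvg R (fun n y => f y * Ge n y) f (fun y => `|f y|).
- move=> n; apply: measurable_funM; first exact: L1_measurable.
  exact: (continuous_measurable (@cGe n)).
- move=> y; rewrite -[X in _ --> X]mulr1; apply: cvgM; first exact: cvg_cst.
  rewrite -(_ : G 0 = 1); last by rewrite /gauss_fun expr0n oppr0 expR0.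
  apply: (@continuous_cvg _ _ _ _ _ (fun n => harmonic n * y) G 0).
    exact: (rschwartz_continuous rschwartz_gauss).
  rewrite -(mul0r y); apply: cvgM; last exact: cvg_cst.
  exact: cvg_harmonic.
- exact: L1_norm.
- move=> n y; rewrite normrM ler_piMr// ger0_norm ?gauss_fun_ge0//.
  exact: gauss_fun_le1.
Qed.

Let jp n : L1 (fun y => cos (x * y) * Ge n y).
Proof. exact: L1_cos. Qed.

Let jq n : L1 (fun y => sin (x * y) * Ge n y).
Proof. exact: L1_sin. Qed.

(** With the cut-off, the integrals may be exchanged: by the addition formula
    for the cosine, the inner integral becomes the cosine transform of a wide
    Gaussian at [y - x], which is a Gaussian window around [x]. *)
Lemma trig_inversion_even :
  cosT (cosT a) x + sinT (sinT a) x = 2 * pi * a x.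
Proof.
have j1 := L1_cos x jca; have j2 := L1_sin x jsa.
rewrite /cosT /sinT -ID//.
have cv := cutoff_cvg (L1_add j1 j2).
have E n : I (fun y => (cos (x * y) * cosT a y + sin (x * y) * sinT a y) *
    Ge n y) = 2 * Num.sqrt pi * I (fun z => a (2 * harmonic n * z + x) * G z).
  have p2 : 0 < 2 * harmonic n :> R by rewrite mulr_gt0.
  have [C aC] := rschwartz_bounded sa.
  transitivity (I (fun y => a y * cosT (fun z => cos (x * z) * Ge n z) y) +
                I (fun y => a y * sinT (fun z => sin (x * z) * Ge n z) y)).
    rewrite -cosT_exchange// -sinT_exchange// -ID.
    - by congr Rintegral; apply/funext => y; ring.
    - have := L1_mul_cosT (jp n) ja; congr (_.-integrable _ _).
      by apply/funext => y /=; rewrite mulrC.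
    - have := L1_mul_sinT (jq n) ja; congr (_.-integrable _ _).
      by apply/funext => y /=; rewrite mulrC.
  rewrite -ID; [|exact: L1_mul_cosT|exact: L1_mul_sinT].
  (* the cut-off of width 1 / harmonic n becomes a window of width 2 harmonic n *)
  have -> : 2 * Num.sqrt pi = Num.sqrt pi / harmonic n * (2 * harmonic n) :> R.
    by field; exact: lt0r_neq0.
  rewrite -mulrA -(I_gauss_window _ p2 (rschwartz_continuous sa) aC) -IZ.
    congr Rintegral; apply/funext => y.
    rewrite -mulrDr mulrCA; congr (_ * _).
    rewrite -[RHS](_ : cosT (Ge n) (y - x) = _); last first.
      by rewrite cosT_gauss_scale// invfM (mulrC 2^-1) !mulrA.
    rewrite -ID; [|exact: L1_cos|exact: L1_sin].
    congr Rintegral; apply/funext => z.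
    by rewrite mulrBl cosB; ring.
  apply: (@L1_bounded_mul _ _ _ C) => //.
    exact: (continuous_measurable (rschwartz_continuous sa)).
  exact: (rschwartz_L1 (rschwartz_gauss_window x p2)).
move: cv; under eq_fun do rewrite E; move=> cv.
have [C aC] := rschwartz_bounded sa.
have h2 : 2 * harmonic n @[n --> \oo] --> (0 : R).
  rewrite -(mulr0 2); apply: cvgM; [exact: cvg_cst|exact: cvg_harmonic].
have cv2 := @gauss_approximation R a C x _ (rschwartz_continuous sa) aC h2.
have cv3 : 2 * Num.sqrt pi * I (fun z => a (2 * harmonic n * z + x) * G z)
    @[n --> \oo] --> 2 * Num.sqrt pi * (Num.sqrt pi * a x).
  by apply: cvgM; [exact: cvg_cst|exact: cv2].
rewrite (cvg_unique _ cv cv3)//.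
by rewrite -mulrA (mulrA (Num.sqrt pi)) -expr2 sqr_sqrtr ?pi_ge0// mulrA.
Qed.

(** The same computation with the addition formula for the sine produces the
    sine transform of a Gaussian, which vanishes. *)
Lemma trig_inversion_odd : sinT (cosT a) x = cosT (sinT a) x.
Proof.
have j1 := L1_sin x jca; have j2 := L1_cos x jsa.
apply/eqP; rewrite -subr_eq0 /cosT /sinT -IB//.
have cv := cutoff_cvg (L1_sub j1 j2).
have E n : I (fun y => (sin (x * y) * cosT a y - cos (x * y) * sinT a y) *
    Ge n y) = 0.
  transitivity (I (fun y => a y * cosT (fun z => sin (x * z) * Ge n z) y) -
                I (fun y => a y * sinT (fun z => cos (x * z) * Ge n z) y)).
    rewrite -cosT_exchange// -sinT_exchange// -IB.
    - by congr Rintegral; apply/funext => y; ring.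
    - have := L1_mul_cosT (jq n) ja; congr (_.-integrable _ _).
      by apply/funext => y /=; rewrite mulrC.
    - have := L1_mul_sinT (jp n) ja; congr (_.-integrable _ _).
      by apply/funext => y /=; rewrite mulrC.
  rewrite -IB; [|exact: L1_mul_cosT|exact: L1_mul_sinT].
  transitivity (I (fun y => 0 * a y)); last by rewrite IZ// mul0r.
  congr Rintegral; apply/funext => y; rewrite -mulrBr mulrC; congr (_ * _).
  rewrite -IB; [|exact: L1_cos|exact: L1_sin].
  rewrite -(sinT_gauss_scale (x - y) (e0 n)); congr Rintegral.
  by apply/funext => z; rewrite mulrBl sinB; ring.
move: cv; under eq_fun do rewrite E; move=> cv.
have cz : (0 : R) @[_ --> \oo] --> (0 : R) by exact: cvg_cst.
by apply/eqP; exact: (cvg_unique _ cv cz).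
Qed.

End trigonometric_inversion.

(** * Complex-valued functions and the Fourier transform *)

Section complex_components.
Context {R : realType}.
Implicit Types z w : R[i].

Lemma cReM z w : complex.Re (z * w) =
  complex.Re z * complex.Re w - complex.Im z * complex.Im w.
Proof. by case: z w => [a b] [c d]. Qed.

Lemma cImM z w : complex.Im (z * w) =
  complex.Re z * complex.Im w + complex.Im z * complex.Re w.
Proof. by case: z w => [a b] [c d]. Qed.

Lemma cReD z w : complex.Re (z + w) = complex.Re z + complex.Re w.
Proof. by case: z w => [a b] [c d]. Qed.

Lemma cImD z w : complex.Im (z + w) = complex.Im z + complex.Im w.
Proof. by case: z w => [a b] [c d]. Qed.

Lemma cReN z : complex.Re (- z) = - complex.Re z.
Proof. by case: z. Qed.

Lemma cImN z : complex.Im (- z) = - complex.Im z.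
Proof. by case: z. Qed.

Lemma complex_ext z w : complex.Re z = complex.Re w ->
  complex.Im z = complex.Im w -> z = w.
Proof. by case: z w => [a b] [c d] /= -> ->. Qed.

Lemma cReZ (r : R) z : complex.Re (r%:C * z) = r * complex.Re z.
Proof. by rewrite cReM /= mul0r subr0. Qed.

Lemma cImZ (r : R) z : complex.Im (r%:C * z) = r * complex.Im z.
Proof. by rewrite cImM /= mul0r addr0. Qed.

Lemma mulrC1 z : z * (1 : R)%:C = z.
Proof. by apply: complex_ext; rewrite ?cReM ?cImM /= mulr1 mulr0 ?subr0 ?add0r. Qed.

Lemma normcZ (r : R) z : normc (r%:C * z) = `|r| * normc z.
Proof. by rewrite normcM /normc/= expr0n addr0 sqrtr_sqr; case: z. Qed.

Lemma normc_ge0 z : 0 <= normc z.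
Proof. by case: z => a b; exact: sqrtr_ge0. Qed.

Lemma Re_le_normc z : `|complex.Re z| <= normc z.
Proof.
by case: z => a b; rewrite /= -sqrtr_sqr ler_wsqrtr// lerDl sqr_ge0.
Qed.

Lemma Im_le_normc z : `|complex.Im z| <= normc z.
Proof.
by case: z => a b; rewrite /= -sqrtr_sqr ler_wsqrtr// lerDr sqr_ge0.
Qed.

Lemma normc_le z : normc z <= `|complex.Re z| + `|complex.Im z|.
Proof.
case: z => a b /=; rewrite -[leRHS]ger0_norm ?addr_ge0// -sqrtr_sqr.
rewrite ler_wsqrtr// sqrrD !real_normK ?num_real// lerD2r lerDl.
by rewrite mulrn_wge0 ?mulr_ge0.
Qed.

Lemma ereal_sup_range_lty (f : R -> R) :
  (ereal_sup (range (fun y => (f y)%:E)) < +oo)%E <->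
  exists C : R, forall y, f y <= C.
Proof.
split=> [h|[C fC]].
  exists (fine (ereal_sup (range (fun y => (f y)%:E)))) => y.
  have yle : ((f y)%:E <= ereal_sup (range (fun y => (f y)%:E)))%E.
    by apply: ereal_sup_ubound; exists y.
  by move: yle h; case: ereal_sup => //= r; rewrite lee_fin.
apply: (@le_lt_trans _ _ C%:E); last exact: ltry.
by apply: ge_ereal_sup => _ [y _ <-]; rewrite lee_fin.
Qed.

End complex_components.

Section complex_schwartz.
Context {R : realType}.
Implicit Types g h : R -> R[i].

Lemma iter_cderiv g m : iter m cderiv g =
  (fun t => derive1n m (reF g) t +i* derive1n m (imF g) t).
Proof.
elim: m => [|m IH]; first by apply/funext => t; apply: complex_ext.
rewrite iterS IH; apply/funext => t.
by rewrite !derive1nS /cderiv /reF /imF /=.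
Qed.

Lemma schwartz_components g :
  schwartz g <-> rschwartz (reF g) /\ rschwartz (imF g).
Proof.
have seminormE k m : schwartz_seminorm k m g = ereal_sup (range (fun y =>
    (normc ((y ^+ k)%:C * (derive1n m (reF g) y +i* derive1n m (imF g) y)))%:E)).
  by rewrite /schwartz_seminorm iter_cderiv.
split=> [[[sa sb] bg]|[[sa ba] [sb bb]]].
  split; split=> // k m; have := bg k m; rewrite seminormE.
    move=> /ereal_sup_range_lty[C bC]; exists C => y.
    apply: le_trans (bC y); apply: le_trans (Re_le_normc _).
    by rewrite cReZ.
  move=> /ereal_sup_range_lty[C bC]; exists C => y.
  apply: le_trans (bC y); apply: le_trans (Im_le_normc _).
  by rewrite cImZ.
split=> // k m; rewrite seminormE; apply/ereal_sup_range_lty.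
have [C bC] := ba k m; have [D bD] := bb k m; exists (C + D) => y.
rewrite (le_trans (normc_le _))// cReZ cImZ.
exact: lerD.
Qed.

Lemma schwartz_real (a : R -> R) : rschwartz a -> schwartz (fun x => (a x)%:C).
Proof.
move=> sa; apply/schwartz_components; split=> //.
rewrite (_ : imF _ = (fun x => 0 * a x)); first exact: rschwartzZ.
by apply/funext => x; rewrite mul0r.
Qed.

End complex_schwartz.

Section complex_integrals.
Context {R : realType}.
Local Notation mu := (@lebesgue_measure R).
Local Notation L1 f := (mu.-integrable setT (EFin \o f)).
Local Notation I f := (Rintegral mu setT f).
Implicit Types f g h : R -> R[i].

Lemma cintegrableM_bounded f g C : measurable_fun setT (reF f) ->
  measurable_fun setT (imF f) -> (forall x, normc (f x) <= C) ->
  cintegrable g -> cintegrable (fun x => f x * g x).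
Proof.
move=> ma mb fC [ja jb].
have aC x : `|reF f x| <= C by exact: le_trans (Re_le_normc _) (fC x).
have bC x : `|imF f x| <= C by exact: le_trans (Im_le_normc _) (fC x).
split.
  rewrite (_ : reF _ = (fun x => reF f x * reF g x - imF f x * imF g x)).
    by apply: L1_sub; [exact: L1_bounded_mul aC ja|exact: L1_bounded_mul bC jb].
  by apply/funext => x; rewrite /reF cReM.
rewrite (_ : imF _ = (fun x => reF f x * imF g x + imF f x * reF g x)).
  by apply: L1_add; [exact: L1_bounded_mul aC jb|exact: L1_bounded_mul bC ja].
by apply/funext => x; rewrite /imF cImM.
Qed.

Lemma cintegrable_lin (a : R[i]) f g : cintegrable f -> cintegrable g ->
  cintegrable (fun x => a * f x + g x).
Proof.
move=> [jf1 jf2] [jg1 jg2]; split.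
  rewrite (_ : reF _ = (fun x => (complex.Re a * reF f x -
    complex.Im a * imF f x) + reF g x)).
    by apply: L1_add => //; apply: L1_sub; exact: L1_scale.
  by apply/funext => x; rewrite /reF cReD cReM.
rewrite (_ : imF _ = (fun x => (complex.Re a * imF f x +
  complex.Im a * reF f x) + imF g x)).
  by apply: L1_add => //; apply: L1_add; exact: L1_scale.
by apply/funext => x; rewrite /imF cImD cImM.
Qed.

Lemma cintegral_lin (a : R[i]) f g : cintegrable f -> cintegrable g ->
  cintegral (fun x => a * f x + g x) = a * cintegral f + cintegral g.
Proof.
move=> [jf1 jf2] [jg1 jg2].
apply: complex_ext; rewrite ?cReD ?cImD ?cReM ?cImM /=.
  rewrite -!IZ// -IB; [|exact: L1_scale|exact: L1_scale].
  rewrite -ID//; last by apply: L1_sub; exact: L1_scale.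
  by congr Rintegral; apply/funext => x; rewrite /reF cReD cReM.
rewrite -!IZ// -ID; [|exact: L1_scale|exact: L1_scale].
rewrite -ID//; last by apply: L1_add; exact: L1_scale.
by congr Rintegral; apply/funext => x; rewrite /imF cImD cImM.
Qed.

(** Used for the linearity of the identification of distributions with
    functions. *)
Lemma is_function_lin S w (u v : functional R) (a : R[i]) f g :
  is_function S w u f -> is_function S w v g ->
  is_function S w (fun phi => a * u phi + v phi) (fun t => a * f t + g t).
Proof.
move=> uf vg phi Sphi.
have [jf uE] := uf phi Sphi; have [jg vE] := vg phi Sphi.
have e : (fun t => (a * f t + g t) * phi t * (w t)%:C) =
    (fun t => a * (f t * phi t * (w t)%:C) + g t * phi t * (w t)%:C).
  by apply/funext => t; rewrite !mulrDl !mulrA.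
split; first by rewrite e; exact: cintegrable_lin.
by rewrite e cintegral_lin// uE vE.
Qed.

End complex_integrals.

Section fourier_inversion.
Context {R : realType}.
Local Notation mu := (@lebesgue_measure R).
Local Notation L1 f := (mu.-integrable setT (EFin \o f)).
Local Notation I f := (Rintegral mu setT f).
Local Notation c := ((Num.sqrt (2 * @pi R))^-1).
Implicit Types f g h : R -> R[i].

(** The components of [(2 pi)^(-1/2) \int e^(i xi y) h xi dxi]. *)
Definition inverse_fourier h : R -> R[i] := fun y =>
  c * (cosT (reF h) y - sinT (imF h) y) +i*
  (c * (cosT (imF h) y + sinT (reF h) y)).

Lemma fourier_components g : cintegrable g -> fourier g = (fun xi =>
  c * (cosT (reF g) xi + sinT (imF g) xi) +i*
  (c * (cosT (imF g) xi - sinT (reF g) xi))).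
Proof.
move=> [ja jb]; apply/funext => xi.
apply: complex_ext; rewrite /fourier ?cReM ?cImM /= mul0r ?subr0 ?addr0;
  congr (_ * _).
  rewrite /cosT /sinT -ID; [|exact: L1_cos|exact: L1_sin].
  congr Rintegral; apply/funext => y; rewrite /reF cReM /imF/=.
  by rewrite mulNr opprK.
rewrite /cosT /sinT -IB; [|exact: L1_cos|exact: L1_sin].
congr Rintegral; apply/funext => y; rewrite /imF cImM /reF/=.
by rewrite mulNr.
Qed.

Lemma schwartz_cintegrable g : schwartz g -> cintegrable g.
Proof.
by move=> /schwartz_components[sa sb]; split; exact: rschwartz_L1.
Qed.

Lemma schwartz_inverse_fourier g : schwartz g -> schwartz (inverse_fourier g).
Proof.
move=> /schwartz_components[sa sb]; apply/schwartz_components; split.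
  apply/rschwartzZ/rschwartzB; [exact: rschwartz_cosT|exact: rschwartz_sinT].
apply/rschwartzZ/rschwartzD; [exact: rschwartz_cosT|exact: rschwartz_sinT].
Qed.

(** Expanding both transforms into components, the two inversion formulas leave
    [2 pi] times each component of [g]. *)
Lemma inverse_fourierK g : schwartz g -> fourier (inverse_fourier g) = g.
Proof.
move=> sg; have /schwartz_components[sa sb] := sg.
rewrite fourier_components; last first.
  exact/schwartz_cintegrable/schwartz_inverse_fourier.
set a := reF g in sa *; set b := imF g in sb *.
have [jCa jSa] := (rschwartz_L1 (rschwartz_cosT sa), rschwartz_L1 (rschwartz_sinT sa)).
have [jCb jSb] := (rschwartz_L1 (rschwartz_cosT sb), rschwartz_L1 (rschwartz_sinT sb)).
have cc : c * c = (2 * pi)^-1.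
  by rewrite -invfM -expr2 sqr_sqrtr// mulr_ge0// pi_ge0.
have p0 : 2 * pi != 0 :> R by rewrite mulf_neq0// gt_eqF// pi_gt0.
have cosTB p q x : L1 p -> L1 q ->
    cosT (fun y => c * (p y - q y)) x = c * (cosT p x - cosT q x).
  move=> jp jq; rewrite /cosT -IB; [|exact: L1_cos|exact: L1_cos].
  rewrite -IZ; last by apply: L1_sub; exact: L1_cos.
  by congr Rintegral; apply/funext => y; ring.
have cosTD p q x : L1 p -> L1 q ->
    cosT (fun y => c * (p y + q y)) x = c * (cosT p x + cosT q x).
  move=> jp jq; rewrite /cosT -ID; [|exact: L1_cos|exact: L1_cos].
  rewrite -IZ; last by apply: L1_add; exact: L1_cos.
  by congr Rintegral; apply/funext => y; ring.
have sinTB p q x : L1 p -> L1 q ->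
    sinT (fun y => c * (p y - q y)) x = c * (sinT p x - sinT q x).
  move=> jp jq; rewrite /sinT -IB; [|exact: L1_sin|exact: L1_sin].
  rewrite -IZ; last by apply: L1_sub; exact: L1_sin.
  by congr Rintegral; apply/funext => y; ring.
have sinTD p q x : L1 p -> L1 q ->
    sinT (fun y => c * (p y + q y)) x = c * (sinT p x + sinT q x).
  move=> jp jq; rewrite /sinT -ID; [|exact: L1_sin|exact: L1_sin].
  rewrite -IZ; last by apply: L1_add; exact: L1_sin.
  by congr Rintegral; apply/funext => y; ring.
have recombineB (X Y Z W A : R) : X + Y = 2 * pi * A -> Z = W ->
    c * (c * (X - W) + c * (Z + Y)) = A.
  move=> e ->; rewrite -mulrDr mulrA cc addrA subrK e mulKf//.
have recombineD (X Y Z W A : R) : X + Y = 2 * pi * A -> Z = W ->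
    c * (c * (X + W) - c * (Z - Y)) = A.
  move=> e ->; rewrite -mulrBr mulrA cc opprB addrA addrAC addrK.
  by rewrite e mulKf.
apply/funext => x; apply: complex_ext => /=.
  rewrite cosTB// sinTD//.
  exact: (recombineB _ _ _ _ _ (trig_inversion_even x sa)
    (trig_inversion_odd x sb)).
rewrite cosTD// sinTB//.
exact: (recombineD _ _ _ _ _ (trig_inversion_even x sb)
  (trig_inversion_odd x sa)).
Qed.

Lemma continuous_inverse_fourier h : cintegrable h ->
  continuous (reF (inverse_fourier h)) /\ continuous (imF (inverse_fourier h)).
Proof.
move=> [ja jb]; split => x; apply: cvgM; try exact: cvg_cst.
  by apply: cvgB; [exact: continuous_cosT|exact: continuous_sinT].
by apply: cvgD; [exact: continuous_cosT|exact: continuous_sinT].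
Qed.

Lemma inverse_fourier_bounded h y : cintegrable h ->
  normc (inverse_fourier h y) <=
  c * (2 * (I (fun x => `|reF h x|) + I (fun x => `|imF h x|))).
Proof.
move=> [ja jb]; rewrite (le_trans (normc_le _))//=.
have c0 : 0 <= c by rewrite invr_ge0 sqrtr_ge0.
rewrite !normrM ger0_norm// -mulrDr ler_wpM2l//.
have := cosT_bounded y ja; have := cosT_bounded y jb.
have := sinT_bounded y ja; have := sinT_bounded y jb.
have := ler_normB (cosT (reF h) y) (sinT (imF h) y).
have := ler_normD (cosT (imF h) y) (sinT (reF h) y).
by lra.
Qed.

(** The kernel of the inverse transform is symmetric in its two variables; each
    of the products of components is exchanged by [cosT_exchange] or
    [sinT_exchange]. *)
Lemma cintegral_inverse_fourier_exchange h g : cintegrable h -> cintegrable g ->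
  cintegral (fun x => h x * inverse_fourier g x) =
  cintegral (fun y => inverse_fourier h y * g y).
Proof.
move=> [jp jq] [ja jb].
set p := reF h in jp *; set q := imF h in jq *.
set a := reF g in ja *; set b := imF g in jb *.
have sum4 (k1 k2 k3 k4 : R -> R) (s t r : R) : L1 k1 -> L1 k2 -> L1 k3 -> L1 k4 ->
    I (fun x => c * (k1 x + s * k2 x + t * k3 x + r * k4 x)) =
    c * (I k1 + s * I k2 + t * I k3 + r * I k4).
  move=> j1 j2 j3 j4.
  have [j2' j3'] := (L1_scale s j2, L1_scale t j3).
  have j4' := L1_scale r j4.
  have j12 := L1_add j1 j2'; have j123 := L1_add j12 j3'.
  by rewrite IZ ?ID ?IZ//; exact: L1_add.
have cosTr (f1 f2 : R -> R) : L1 f1 -> L1 f2 ->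
    L1 (fun x => cosT f1 x * f2 x).
  move=> j1 j2; have := L1_mul_cosT j2 j1; congr (_.-integrable _ _).
  by apply/funext => x /=; rewrite mulrC.
have sinTr (f1 f2 : R -> R) : L1 f1 -> L1 f2 ->
    L1 (fun x => sinT f1 x * f2 x).
  move=> j1 j2; have := L1_mul_sinT j2 j1; congr (_.-integrable _ _).
  by apply/funext => x /=; rewrite mulrC.
apply: complex_ext => /=.
  transitivity (c * (I (fun x => p x * cosT a x) + (-1) * I (fun x => p x * sinT b x)
    + (-1) * I (fun x => q x * cosT b x) + (-1) * I (fun x => q x * sinT a x))).
    rewrite -sum4; [|exact: L1_mul_cosT|exact: L1_mul_sinT|exact: L1_mul_cosT
      |exact: L1_mul_sinT].
    congr Rintegral; apply/funext => x.
    rewrite /reF cReM /= -[complex.Re (h x)]/(p x) -[complex.Im (h x)]/(q x).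
    by ring.
  rewrite -!cosT_exchange// -!sinT_exchange// -sum4; [|exact: cosTr
    |exact: sinTr|exact: cosTr|exact: sinTr].
  congr Rintegral; apply/funext => x.
  rewrite /reF cReM /= -[complex.Re (g x)]/(a x) -[complex.Im (g x)]/(b x).
  by rewrite /reF /imF -/p -/q; ring.
transitivity (c * (I (fun x => p x * cosT b x) + 1 * I (fun x => p x * sinT a x)
  + 1 * I (fun x => q x * cosT a x) + (-1) * I (fun x => q x * sinT b x))).
  rewrite -sum4; [|exact: L1_mul_cosT|exact: L1_mul_sinT|exact: L1_mul_cosT
    |exact: L1_mul_sinT].
  congr Rintegral; apply/funext => x.
  rewrite /imF cImM /= -[complex.Re (h x)]/(p x) -[complex.Im (h x)]/(q x).
  by ring.
rewrite -!cosT_exchange// -!sinT_exchange// -sum4; [|exact: cosTr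
  |exact: sinTr|exact: cosTr|exact: sinTr].
congr Rintegral; apply/funext => x.
rewrite /imF cImM /= -[complex.Re (g x)]/(a x) -[complex.Im (g x)]/(b x).
by rewrite /reF /imF -/p -/q; ring.
Qed.

End fourier_inversion.

(** * The classical Sobolev embedding *)

Section sobolev_functions.
Context {R : realType}.
Local Notation mu := (@lebesgue_measure R).
Local Notation L1 f := (mu.-integrable setT (EFin \o f)).
Local Notation I f := (Rintegral mu setT f).
Local Notation c := ((Num.sqrt (2 * @pi R))^-1).
Local Notation w s := (fun xi : R => (1 + `|xi| ^+ 2) `^ s).
Implicit Types (f g h : R -> R[i]) (v : functional R).

Lemma onePsqr_gt0 (x : R) : 0 < 1 + `|x| ^+ 2.
Proof. by rewrite ltr_pwDl// exprn_ge0. Qed.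

Lemma continuous_weight (s : R) : continuous (w s).
Proof.
move=> x.
have cn : continuous (fun x : R => 1 + `|x| ^+ 2).
  move=> y; apply: cvgD; first exact: cvg_cst.
  apply: (@continuous_comp _ _ _ (fun x : R => `|x|) (fun x => x ^+ 2)).
    exact: norm_continuous.
  exact: exprn_continuous.
have cp : {for 1 + `|x| ^+ 2, continuous (fun y => y `^ s)}.
  apply: derivable_cont.
  by apply: derivable_powR; rewrite in_itv/= onePsqr_gt0.
exact: (@continuous_comp _ _ _ (fun x : R => 1 + `|x| ^+ 2) (fun y => y `^ s) x
  (cn x) cp).
Qed.

(** The weight is at most a multiple of [(1 + |x|)^(- 2 s)], and [2 s > 1]. *)
Lemma L1_weight (s : R) : 1 / 2 < s -> L1 (w (- s)).
Proof.
move=> hs; have s0 : 0 < s by rewrite (lt_trans _ hs)// divr_gt0.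
have h2 : 1 < 2 * s by rewrite mulrC -ltr_pdivrMr.
apply: (L1_dominated _ (L1_scale (2 `^ s) (L1_decay h2))).
  exact: (continuous_measurable (@continuous_weight (- s))).
move=> x; have p0 := onePsqr_gt0 x.
have q0 : 0 < 1 + `|x| by rewrite ltr_pwDl.
rewrite ger0_norm ?powR_ge0// !powRN ler_pdivlMr ?powR_gt0//.
rewrite ler_pdivrMl ?powR_gt0// powRrM (powR_mulrn 2 (ltW q0)).
rewrite mulrC -powRM ?(ltW p0)//.
apply: ge0_ler_powR; rewrite ?nnegrE ?(ltW s0) ?exprn_ge0 ?(ltW q0)//.
by rewrite (le_trans (onePsqr_le x))// real_normK ?num_real.
Qed.

(** With [w] the Sobolev weight, [2 |h| <= t w |h|^2 + 1 / (t w)] for every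
    [t > 0]. Integrating and choosing [t] close to the inverse of the norm of
    [h] makes the bound proportional to this norm. The statement concerns a
    function [u] dominated by [h] so as to apply to both components. *)
Lemma sobolev_energy_L1 (s : R) h (u : R -> R) : 1 / 2 < s ->
  measurable_fun setT (reF h) -> measurable_fun setT (imF h) ->
  (sobolev_energy s h < +oo)%E ->
  measurable_fun setT u -> (forall x, `|u x| <= normc (h x)) ->
  L1 u /\ I (fun x => `|u x|) <=
    (1 + I (w (- s))) / 2 * Num.sqrt (fine (sobolev_energy s h)).
Proof.
move=> hs mp mq E_fin mu_ uh.
pose n2 := fun x => w s x * normc (h x) ^+ 2.
have n2E x : normc (h x) ^+ 2 = reF h x ^+ 2 + imF h x ^+ 2.
  by rewrite /reF /imF; case: (h x) => a b /=;
    rewrite sqr_sqrtr// addr_ge0// sqr_ge0.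
have w0 x r : 0 < w r x by apply: powR_gt0; exact: onePsqr_gt0.
have n20 x : 0 <= n2 x by rewrite mulr_ge0 ?(ltW (w0 _ _)) ?sqr_ge0.
have jn2 : L1 n2.
  apply/integrableP; split.
    apply/measurable_EFinP; apply: measurable_funM.
      exact: (continuous_measurable (@continuous_weight s)).
    rewrite (_ : (fun x => _) = (fun x => reF h x ^+ 2 + imF h x ^+ 2)).
      by apply: measurable_funD; exact: measurable_funX.
    exact/funext.
  move: E_fin; rewrite /sobolev_energy; congr (_ < _)%E.
  by apply: eq_integral => x _ /=; rewrite (ger0_norm (n20 x)).
have jw := L1_weight hs.
have K0 : 0 <= I (w (- s)) by apply: Rintegral_ge0 => x _; exact: powR_ge0.
set E := fine _.
have EE : E = I n2 by [].
have E0 : 0 <= E by rewrite EE; apply: Rintegral_ge0 => x _; exact: n20.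
have amgm (t : R) x : 0 < t ->
    `|u x| <= t / 2 * n2 x + (2 * t)^-1 * w (- s) x.
  move=> t0; apply: le_trans (uh x) _.
  rewrite /n2 powRN; have := w0 x s; set ww := _ `^ s => ww0.
  have wt0 : 0 < ww * t by exact: mulr_gt0.
  rewrite -subr_ge0.
  have -> : t / 2 * (ww * normc (h x) ^+ 2) + (2 * t)^-1 * ww^-1 - normc (h x) =
      (ww * t * normc (h x) - 1) ^+ 2 / (2 * (ww * t)).
    by field; rewrite !gt_eqF.
  by rewrite divr_ge0 ?sqr_ge0// mulr_ge0// ltW.
have jb t : L1 (fun x => t / 2 * n2 x + (2 * t)^-1 * w (- s) x).
  by apply: L1_add; exact: L1_scale.
have ju : L1 u.
  by apply: (L1_dominated mu_ (jb 1)) => x; exact: amgm.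
split=> //.
have bound (t : R) : 0 < t ->
    I (fun x => `|u x|) <= t / 2 * E + (2 * t)^-1 * I (w (- s)).
  move=> t0; rewrite EE -!IZ// -ID; [|exact: L1_scale|exact: L1_scale].
  apply: le_Rintegral; first by [].
  - exact: L1_norm.
  - exact: jb.
  - by move=> x _; exact: amgm.
apply/ler_addgt0Pr => e e0.
set r := Num.sqrt E; have r0 : 0 <= r by exact: sqrtr_ge0.
have Er : E = r ^+ 2 by rewrite sqr_sqrtr.
(* [t] is the inverse of [r + d] rather than of [r], as [r] may vanish; this
   costs at most [d * I (w (- s)) / 2 <= e] *)
pose d := 2 * e / (1 + I (w (- s))).
have K1 : 0 < 1 + I (w (- s)) by rewrite ltr_pwDl.
have d0 : 0 < d by rewrite divr_gt0// mulr_gt0.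
have rd : 0 < r + d by rewrite ltr_wpDl.
have := bound (r + d)^-1; rewrite invr_gt0 => /(_ rd).
move=> /le_trans; apply.
rewrite invfM invrK Er.
have h1 : (r + d)^-1 / 2 * r ^+ 2 <= r / 2.
  rewrite mulrAC ler_pM2r ?invr_gt0// ler_pdivrMl// expr2 ler_wpM2r//.
  by rewrite lerDl ltW.
have h3 : d * (1 + I (w (- s))) = 2 * e by rewrite divfK// gt_eqF.
move: h1 h3 K0 d0 r0; set X := _ * r ^+ 2; set K := I _; move=> h1 h3 K0 d0 r0.
have : d * K <= 2 * e by rewrite -h3 ler_wpM2l ?(ltW d0)// lerDr.
move: h1; rewrite (_ : 2^-1 = 1 / 2) ?mul1r//; nra.
Qed.

Definition bounded_continuous f := [/\ continuous (reF f), continuous (imF f) &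
  exists C : R, forall y, normc (f y) <= C].

(** The function is the inverse transform of the integrable function that the
    Fourier transform of [v] is. *)
Lemma sobolev_function (s : R) : 1 / 2 < s -> exists M : R, forall v, sobolev s v ->
  exists f, [/\ bounded_continuous f, is_function schwartz (fun=> 1) v f &
    forall y, normc (f y) <= M * sobolev_norm s v].
Proof.
move=> hs; exists (c * (2 * ((1 + I (w (- s))) / 2 + (1 + I (w (- s))) / 2))).
move=> v [_ [h0 h0P] E_fin].
have := xgetPex (fun=> 0) (ex_intro (is_locint_function (fourier_dist v)) h0 h0P).
rewrite -/(function_of (fourier_dist v)).
rewrite /sobolev_norm; move: E_fin.
set h := function_of _; move=> E_fin [[[mp _ _] [mq _ _]] hF].
have [jp Ip] := sobolev_energy_L1 hs mp mq E_fin mp (fun x => Re_le_normc (h x)).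
have [jq Iq] := sobolev_energy_L1 hs mp mq E_fin mq (fun x => Im_le_normc (h x)).
have jh : cintegrable h by [].
have f_le y : normc (inverse_fourier h y) <=
    c * (2 * ((1 + I (w (- s))) / 2 + (1 + I (w (- s))) / 2)) *
    Num.sqrt (fine (sobolev_energy s h)).
  apply: le_trans (inverse_fourier_bounded y jh) _.
  rewrite -!mulrA ler_wpM2l ?invr_ge0 ?sqrtr_ge0// ler_wpM2l// mulrDl.
  exact: lerD.
have [cp cq] := continuous_inverse_fourier jh.
exists (inverse_fourier h); split=> //.
  by split=> //; eexists => y; exact: f_le.
move=> g sg.
have [_ vE] := hF _ (schwartz_inverse_fourier sg).
have jg := schwartz_cintegrable sg.
have e : (fun t => inverse_fourier h t * g t * (1 : R)%:C) =
    (fun t => inverse_fourier h t * g t).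
  by apply/funext => t; exact: mulrC1.
split.
  rewrite e; apply: cintegrableM_bounded f_le jg.
    exact: (continuous_measurable cp).
  exact: (continuous_measurable cq).
rewrite e -cintegral_inverse_fourier_exchange//.
rewrite -[in LHS](inverse_fourierK sg) -/(fourier_dist v _) vE.
by congr cintegral; apply/funext => t; rewrite mulrC1.
Qed.

(** Real test functions separate the real and imaginary parts. *)
Lemma bounded_continuous_unique v f g :
  bounded_continuous f -> bounded_continuous g ->
  is_function schwartz (fun=> 1) v f -> is_function schwartz (fun=> 1) v g ->
  f = g.
Proof.
move=> [cf1 cf2 [C fC]] [cg1 cg2 [D gD]] vf vg.
have key (a : R -> R) : rschwartz a ->
    I (fun x => (reF f x - reF g x) * a x) = 0 /\
    I (fun x => (imF f x - imF g x) * a x) = 0.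
  move=> sa; have [[jf1 jf2] fE] := vf _ (schwartz_real sa).
  have [[jg1 jg2] gE] := vg _ (schwartz_real sa).
  have /eqP := etrans (esym fE) gE; rewrite eq_complex /= => /andP[/eqP e1 /eqP e2].
  have reE (k : R -> R[i]) : reF (fun t => k t * (a t)%:C * (1 : R)%:C) =
      (fun x => reF k x * a x).
    by apply/funext => x; rewrite /reF [k x * _ * _]mulrC1 cReM/= mulr0 subr0.
  have imE (k : R -> R[i]) : imF (fun t => k t * (a t)%:C * (1 : R)%:C) =
      (fun x => imF k x * a x).
    by apply/funext => x; rewrite /imF [k x * _ * _]mulrC1 cImM/= mulr0 add0r.
  move: e1 e2 jf1 jf2 jg1 jg2; rewrite !reE !imE => e1 e2 jf1 jf2 jg1 jg2.
  split.
    rewrite (_ : (fun x => _) = (fun x => reF f x * a x - reF g x * a x)).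
      by rewrite IB// e1 subrr.
    by apply/funext => x; rewrite mulrBl.
  rewrite (_ : (fun x => _) = (fun x => imF f x * a x - imF g x * a x)).
    by rewrite IB// e2 subrr.
  by apply/funext => x; rewrite mulrBl.
apply/funext => x; apply: complex_ext; apply/eqP; rewrite -subr_eq0; apply/eqP.
  apply: (@eq0_of_schwartz_orthogonal _ (fun x => reF f x - reF g x) (C + D)).
  - by move=> y; apply: cvgB; [exact: cf1|exact: cg1].
  - move=> y; rewrite (le_trans (ler_normB _ _))// lerD//.
      exact: le_trans (Re_le_normc _) (fC y).
    exact: le_trans (Re_le_normc _) (gD y).
  - by move=> a /key[].
apply: (@eq0_of_schwartz_orthogonal _ (fun x => imF f x - imF g x) (C + D)).
- by move=> y; apply: cvgB; [exact: cf2|exact: cg2].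
- move=> y; rewrite (le_trans (ler_normB _ _))// lerD//.
    exact: le_trans (Im_le_normc _) (fC y).
  exact: le_trans (Im_le_normc _) (gD y).
- by move=> a /key[].
Qed.

End sobolev_functions.

(** * Pointwise properties of continuous functions *)

Section continuous_functions.
Context {R : realType}.
Local Notation mu := (@lebesgue_measure R).
Implicit Types f : R -> R[i].

(** The set where the bound fails is open, and a nonempty open set contains a
    ball, which has positive measure. *)
Lemma ae_le_everywhere (f : R -> R) (B : R) : continuous f ->
  {ae mu, forall x, f x <= B} -> forall x, f x <= B.
Proof.
move=> cf [A [mA A0 subA]] x; rewrite leNgt; apply/negP => Bf.
have /nbhs_ballP[e /= e0 eB] : \forall y \near x, B < f y.
  exact: (cvgr_gt (f x) (cf x)).
have : (mu (ball x e) <= mu A)%E.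
  apply: le_measure; rewrite ?inE//; first exact: measurable_ball.
  by move=> y /eB fy; apply: subA => /=; rewrite leNgt fy.
by rewrite A0 lebesgue_measure_ball ?(ltW e0)// lee_fin leNgt mulrn_wgt0.
Qed.

Lemma continuous_locally_integrable (f : R -> R) : continuous f ->
  locally_integrable setT f.
Proof.
move=> cf; split; [exact: continuous_measurable|exact: openT|move=> K _ cK].
have := @continuous_compact_integrable R f K cK (continuous_subspaceT cf).
by move=> /integrableP[].
Qed.

Lemma continuous_normc f : continuous (reF f) -> continuous (imF f) ->
  continuous (fun x => normc (f x)).
Proof.
move=> cp cq x.
rewrite (_ : (fun x => _) = (fun x => Num.sqrt (reF f x * reF f x + imF f x * imF f x))).
  have c : continuous (fun x => reF f x * reF f x + imF f x * imF f x).
    move=> y; apply: cvgD; first by apply: cvgM; exact: cp.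
    by apply: cvgM; exact: cq.
  by apply: continuous_cvg; [exact: sqrt_continuous|exact: c].
by apply/funext => y; rewrite /reF /imF; case: (f y) => a b; rewrite -!expr2.
Qed.

Lemma bounded_continuous_normc_le (B : R) f : bounded_continuous f ->
  ('N[mu]_+oo [EFin \o (fun x => normc (f x))] <= B%:E)%E ->
  forall x, normc (f x) <= B.
Proof.
move=> [cp cq _]; rewrite unlock.
have mu0 : (0 < mu [set: R])%E.
  apply: (@lt_le_trans _ _ (mu (ball (0 : R) 1))).
    by rewrite lebesgue_measure_ball ?ler01// lte_fin mulrn_wgt0.
  by apply: le_measure; rewrite ?inE//; exact: measurable_ball.
rewrite mu0 => /ess_supP h; apply: ae_le_everywhere.
  exact: continuous_normc.
apply: filterS h => x /=; rewrite lee_fin; apply: le_trans; exact: ler_norm.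
Qed.

Lemma bounded_continuous_lin (a : R[i]) f g : bounded_continuous f ->
  bounded_continuous g -> bounded_continuous (fun y => a * f y + g y).
Proof.
move=> [cp1 cq1 [C fC]] [cp2 cq2 [D gD]].
have cZ (r : R) (k : R -> R) : continuous k -> continuous (fun y => r * k y).
  by move=> ck y; apply: cvgM; [exact: cvg_cst|exact: ck].
split.
- rewrite (_ : reF _ = (fun y => complex.Re a * reF f y -
    complex.Im a * imF f y + reF g y)).
    move=> y; apply: cvgD; last exact: cp2.
    by apply: cvgB; apply: cZ.
  by apply/funext => y; rewrite /reF cReD cReM.
- rewrite (_ : imF _ = (fun y => complex.Re a * imF f y +
    complex.Im a * reF f y + imF g y)).
    move=> y; apply: cvgD; last exact: cq2.
    by apply: cvgD; apply: cZ.
  by apply/funext => y; rewrite /imF cImD cImM.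
exists (normc a * C + D) => y.
rewrite (le_trans (le_normcD _ _))// normcM lerD// ler_wpM2l//.
exact: normc_ge0.
Qed.

(** The norm of [R[i]] takes its values in [R[i]], so a positive bound [e] is
    first recognized as a real number. *)
Lemma continuous_complex f : continuous (reF f) -> continuous (imF f) ->
  continuous (f : R -> (R[i])^o).
Proof.
move=> cp cq x; apply/cvgrPdist_lt => e e0.
have [e1 ee] : exists e1 : R, e = e1%:C.
  move: e0; rewrite ltcE => /andP[/eqP + _]; case: e => a b /= ->.
  by exists a.
move: e0; rewrite ee (ltcR 0) => e0.
have e2 : 0 < e1 / 2 by rewrite divr_gt0.
near=> t; rewrite normc_def ltcR.
have := normc_le (f x - f t).
case E : (f x - f t) => [a b] /= => h; apply: le_lt_trans h _.
have -> : a = reF f x - reF f t.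
  by have := congr1 (@complex.Re R) E; rewrite cReD cReN.
have -> : b = imF f x - imF f t.
  by have := congr1 (@complex.Im R) E; rewrite cImD cImN.
rewrite [ltRHS]splitr ltrD//; near: t.
  by move/cvgrPdist_lt : (cp x); exact.
by move/cvgrPdist_lt : (cq x); exact.
Unshelve. all: by end_near. Qed.

End continuous_functions.

(** * Transport by the change of variable and the weight *)

Section transport.
Context {R : realType}.
Variables (psi psiV omega : R -> R).
Hypotheses (hpsi : increasing_diffeo psi psiV) (homega : admissible_weight omega).
Local Notation mu := (@lebesgue_measure R).
Local Notation L1 f := (mu.-integrable setT (EFin \o f)).
Local Notation I f := (Rintegral mu setT f).
Implicit Types (f g phi : R -> R[i]) (u : functional R).
Local Notation T := (wT psiV omega).
Local Notation Tinv := (wTinv psi omega).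

Let psi_smooth : smooth psi. Proof. by case: hpsi => -[]. Qed.
Let psiV_smooth : smooth psiV. Proof. by case: hpsi => -[]. Qed.
Let psiK : cancel psi psiV. Proof. by case: hpsi => _ []. Qed.
Let psiVK : cancel psiV psi. Proof. by case: hpsi => _ []. Qed.
Let psi_incr : {homo psi : x y / x < y}. Proof. by case: hpsi. Qed.
Let dpsi_neq0 t : derive1 psi t != 0.
Proof. by case: hpsi => _ _ _ h; rewrite gt_eqF. Qed.
Let omega_gt0 t : 0 < omega t. Proof. by case: homega. Qed.
Let omega_smooth : smooth omega. Proof. by case: homega. Qed.

Let omega_neq0 t : omega t != 0. Proof. by rewrite gt_eqF. Qed.

Lemma reF_scale (r : R -> R) f :
  reF (fun t => (r t)%:C * f t) = (fun t => r t * reF f t).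
Proof. by apply/funext => t; rewrite /reF cReZ. Qed.

Lemma imF_scale (r : R -> R) f :
  imF (fun t => (r t)%:C * f t) = (fun t => r t * imF f t).
Proof. by apply/funext => t; rewrite /imF cImZ. Qed.

Lemma csmooth_wTinv g : csmooth g -> csmooth (Tinv g).
Proof.
have si := smooth_inv omega_neq0 omega_smooth.
move=> [sa sb]; split.
  rewrite (reF_scale (fun t => (omega t)^-1) (fun t => g (psi t))).
  exact: (smoothM si (smooth_comp sa psi_smooth)).
rewrite (imF_scale (fun t => (omega t)^-1) (fun t => g (psi t))).
exact: (smoothM si (smooth_comp sb psi_smooth)).
Qed.

Lemma csmooth_wT phi : csmooth phi -> csmooth (T phi).
Proof.
have so := smooth_comp omega_smooth psiV_smooth.
move=> [sa sb]; split.
  rewrite (reF_scale (fun t => omega (psiV t)) (fun t => phi (psiV t))).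
  exact: (smoothM so (smooth_comp sa psiV_smooth)).
rewrite (imF_scale (fun t => omega (psiV t)) (fun t => phi (psiV t))).
exact: (smoothM so (smooth_comp sb psiV_smooth)).
Qed.

(** The weighted derivative is the ordinary one read in the coordinate
    [y = psi t]. *)
Lemma wderiv_wTinv g : csmooth g -> wderiv psi omega (Tinv g) = Tinv (cderiv g).
Proof.
move=> [sa sb]; apply/funext => t; rewrite /wderiv.
rewrite (_ : (fun x => _) = (fun x => g (psi x))); last first.
  apply/funext => x; rewrite /wTinv mulrA -rmorphM/= mulfV// mul1r//.
have chain (a : R -> R) : smooth a ->
    derive1 (fun x => a (psi x)) t = derive1 psi t * derive1 a (psi t).
  move=> sma; rewrite mulrC.
  have dpsi : derivable psi t 1 by exact: smooth_derivable psi_smooth.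
  by rewrite -(derive1_comp dpsi (sma 0%N (psi t))).
rewrite /wTinv /cderiv; apply: complex_ext.
  rewrite [LHS]cReZ [RHS]cReZ /= (chain (reF g) sa).
  by rewrite invfM -mulrA mulKf.
rewrite [LHS]cImZ [RHS]cImZ /= (chain (imF g) sb).
by rewrite invfM -mulrA mulKf.
Qed.

Lemma csmooth_iter_cderiv g m : csmooth g -> csmooth (iter m cderiv g).
Proof.
move=> [sa sb]; rewrite iter_cderiv.
by split; [exact: (@smooth_derive1n _ m (reF g) sa)|exact: (@smooth_derive1n _ m (imF g) sb)].
Qed.

(** Both suprema range over the same values, since [psi] is onto. *)
Lemma wseminorm_wTinv k m g : csmooth g ->
  wseminorm psi omega k m (Tinv g) = schwartz_seminorm k m g.
Proof.
move=> sg.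
have iterE : iter m (wderiv psi omega) (Tinv g) = Tinv (iter m cderiv g).
  elim: m => [|m IH]; first by [].
  by rewrite !iterS IH (wderiv_wTinv (csmooth_iter_cderiv m sg)).
have E t : (psi t ^+ k * omega t)%:C * iter m (wderiv psi omega) (Tinv g) t =
    (psi t ^+ k)%:C * iter m cderiv g (psi t).
  by rewrite iterE /wTinv mulrA -rmorphM/= mulfK.
rewrite /wseminorm /schwartz_seminorm; congr ereal_sup; apply/seteqP; split.
  by move=> _ [t _ <-]; exists (psi t) => //=; rewrite E.
by move=> _ [y _ <-]; exists (psiV y) => //=; rewrite E psiVK.
Qed.

Lemma wschwartz_wTinv g : schwartz g -> wschwartz psi omega (Tinv g).
Proof.
move=> [sg bg]; split; first exact: csmooth_wTinv.
by move=> k m; rewrite wseminorm_wTinv.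
Qed.

Lemma schwartz_wT phi : wschwartz psi omega phi -> schwartz (T phi).
Proof.
move=> [sphi bphi]; have sT := csmooth_wT sphi; split=> // k m.
by rewrite -wseminorm_wTinv// (wTK hpsi homega).
Qed.

Lemma csmooth_sub f g : csmooth f -> csmooth g -> csmooth (fun t => f t - g t).
Proof.
move=> [sf1 sf2] [sg1 sg2]; split.
  rewrite (_ : reF _ = (fun t => reF f t + (-1) * reF g t)).
    exact: (@smoothD _ (reF f) _ sf1 (@smoothZ _ (-1) (reF g) sg1)).
  by apply/funext => t; rewrite /reF cReD cReN mulN1r.
rewrite (_ : imF _ = (fun t => imF f t + (-1) * imF g t)).
  exact: (@smoothD _ (imF f) _ sf2 (@smoothZ _ (-1) (imF g) sg2)).
by apply/funext => t; rewrite /imF cImD cImN mulN1r.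
Qed.

(** [wTinv] is linear and preserves all seminorms, so neighbourhoods of
    [wTinv f0] pull back to neighbourhoods of [f0]. *)
Lemma tempered_wT_dist u : wdual psi omega u -> tempered (wT_dist psi omega u).
Proof.
move=> [ulin ucont]; split.
  move=> a f g sf sg; rewrite /wT_dist -ulin; [|exact: wschwartz_wTinv
    |exact: wschwartz_wTinv].
  by congr u; apply/funext => t; rewrite /wTinv mulrDr mulrCA.
move=> f0 sf0 e e0.
have [F [d [d0 Fd]]] := ucont _ (wschwartz_wTinv sf0) e e0.
exists F, d; split=> // f sf Ff; apply: Fd; first exact: wschwartz_wTinv.
move=> km kmF; rewrite (_ : (fun t => _) = Tinv (fun t => f t - f0 t)).
  rewrite wseminorm_wTinv; first exact: Ff.
  by apply: csmooth_sub; [case: sf|case: sf0].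
by apply/funext => t; rewrite /wTinv mulrBr.
Qed.

Lemma sobolev_wT_dist s u :
  wsobolev psi omega s u -> sobolev s (wT_dist psi omega u).
Proof. by move=> [du hu eu]; split=> //; exact: tempered_wT_dist. Qed.

(** In the pairing, [omega^2 psi'] absorbs the two weights [1 / omega] of
    [wTinv f] and [phi = wTinv (wT phi)], and leaves the Jacobian of [psi]. *)
Lemma wis_function_wTinv u f : bounded_continuous f ->
  is_function schwartz (fun=> 1) (wT_dist psi omega u) f ->
  wis_function psi omega u (Tinv f).
Proof.
move=> [cp cq _] uf phi sphi.
have sT := schwartz_wT sphi.
have [jf fE] := uf _ sT.
pose k := fun y => f y * T phi y.
have kE : (fun y => f y * T phi y * (1 : R)%:C) = k.
  by apply/funext => y; exact: mulrC1.
move: jf fE; rewrite kE => -[j1 j2] fE.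
have /schwartz_components[sa sb] := sT.
have ck1 : continuous (reF k).
  rewrite (_ : reF k = (fun y => reF f y * reF (T phi) y - imF f y * imF (T phi) y)).
    move=> y; apply: cvgB; apply: cvgM; [exact: cp| |exact: cq|];
      exact: rschwartz_continuous.
  by apply/funext => y; rewrite /reF cReM.
have ck2 : continuous (imF k).
  rewrite (_ : imF k = (fun y => reF f y * imF (T phi) y + imF f y * reF (T phi) y)).
    move=> y; apply: cvgD; apply: cvgM; [exact: cp| |exact: cq|];
      exact: rschwartz_continuous.
  by apply/funext => y; rewrite /imF cImM.
have E : (fun t => Tinv f t * phi t * (omega t ^+ 2 * derive1 psi t)%:C) =
    (fun t => (derive1 psi t)%:C * k (psi t)).
  apply/funext => t; rewrite /wTinv /k /wT psiK.
  set o := omega t; set d := derive1 psi t.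
  have -> : (o ^+ 2 * d)%:C = o%:C * o%:C * d%:C :> R[i].
    by rewrite -!rmorphM expr2.
  have oo : (o^-1)%:C * o%:C = 1 :> R[i].
    by rewrite -rmorphM (mulVf (omega_neq0 t)) rmorph1.
  transitivity ((o^-1)%:C * o%:C * (d%:C * (f (psi t) * (o%:C * phi t)))).
    by ring.
  by rewrite oo mul1r.
have [j1' E1] := change_of_variables psi_incr psiVK psi_smooth ck1 j1.
have [j2' E2] := change_of_variables psi_incr psiVK psi_smooth ck2 j2.
have reE : reF (fun t => (derive1 psi t)%:C * k (psi t)) =
    (fun t => reF k (psi t) * derive1 psi t).
  by rewrite (reF_scale _ (fun t => k (psi t))); apply/funext => t; rewrite mulrC.
have imE : imF (fun t => (derive1 psi t)%:C * k (psi t)) =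
    (fun t => imF k (psi t) * derive1 psi t).
  by rewrite (imF_scale _ (fun t => k (psi t))); apply/funext => t; rewrite mulrC.
rewrite /cintegrable /cintegral E reE imE; split=> //.
rewrite -[in LHS](wTK hpsi homega phi) -/(wT_dist psi omega u _) fE.
by rewrite /cintegral -E1 -E2.
Qed.

End transport.

Theorem theorem5p3 (R : realType) (psi psiV omega : R -> R) (s : R)
    (hpsi : increasing_diffeo psi psiV) (homega : admissible_weight omega)
    (hs : 1 / 2 < s) :
  exists J : functional R -> R -> R[i],
    [/\ (* J is the identification of u with a continuous function *)
        forall u, wsobolev psi omega s u ->
          C0_space omega (J u) /\ wis_function psi omega u (J u),
        (* J is linear *)
        forall (a : R[i]) u v,
          wsobolev psi omega s u -> wsobolev psi omega s v ->
          J (fun phi => a * u phi + v phi) = (fun t => a * J u t + J v t),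
        (* J is well defined and injective *)
        forall u v, wsobolev psi omega s u -> wsobolev psi omega s v ->
          (J u = J v <-> same_on (wschwartz psi omega) u v),
        (* J is continuous *)
        exists M : R, forall u, wsobolev psi omega s u ->
          (C0_norm omega (J u) <= (M * wsobolev_norm psi omega s u)%:E)%E &
        (* pointwise bound with the classical embedding constant *)
        forall Cs : R, sobolev_embedding_constant s Cs ->
          forall u, wsobolev psi omega s u ->
          forall t, normc (J u t) <= Cs / omega t * wsobolev_norm psi omega s u].
Proof.
have [M HM] := sobolev_function hs.
pose P (v : functional R) f :=
  bounded_continuous f /\ is_function schwartz (fun=> 1) v f.
(* [K v] is the continuous function that [v] is; being unique, it depends on the
   values of [v] on Schwartz functions only, and linearly *)
pose K (v : functional R) := xget (fun=> 0) [set f | P v f].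
have KE v f : P v f -> K v = f.
  move=> Pf; have : P v (K v) by apply: (xgetPex (fun=> 0)); exists f.
  by case: Pf => ? ? [? ?]; exact: (@bounded_continuous_unique _ v).
have KP u : wsobolev psi omega s u -> P (wT_dist psi omega u)
    (K (wT_dist psi omega u)) /\
    forall y, normc (K (wT_dist psi omega u) y) <= M * wsobolev_norm psi omega s u.
  move=> /(sobolev_wT_dist hpsi homega)/HM[f [bf vf fM]].
  by have -> : K (wT_dist psi omega u) = f by exact: KE.
have [_ [psiK psiVK] _ _] := hpsi.
have [omega_gt0 somega _] := homega.
(* u(t) = f(psi t) / omega(t), where f is the transported distribution *)
pose J (u : functional R) := wTinv psi omega (K (wT_dist psi omega u)).
have normJ u t : omega t * normc (J u t) = normc (K (wT_dist psi omega u) (psi t)).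
  rewrite /J /wTinv normcZ ger0_norm ?invr_ge0 ?(ltW (omega_gt0 t))// mulrA.
  by rewrite mulfV ?mul1r// gt_eqF.
have JC0 u : wsobolev psi omega s u ->
    (C0_norm omega (J u) <= (M * wsobolev_norm psi omega s u)%:E)%E.
  move=> hu; have [_ KM] := KP u hu.
  by apply: ge_ereal_sup => _ [t _ <-]; rewrite lee_fin normJ.
exists J; split.
- move=> u hu; have [[bf vf] KM] := KP u hu.
  split; last exact: (wis_function_wTinv hpsi homega bf vf).
  split; last by rewrite (le_lt_trans (JC0 u hu))// ltry.
  have [cp cq _] := bf.
  have ci : continuous (fun t => (omega t)^-1).
    exact: (smooth_continuous (smooth_inv (fun t => lt0r_neq0 (omega_gt0 t)) somega)).
  have cpsi : continuous psi by apply: smooth_continuous; case: hpsi => -[].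
  have ccomp (a : R -> R) : continuous a ->
      continuous (fun t => (omega t)^-1 * a (psi t)).
    move=> ca t; apply: cvgM; first exact: ci.
    exact: (continuous_comp (cpsi t) (ca (psi t))).
  apply: continuous_complex.
    rewrite (reF_scale (fun t => (omega t)^-1) (fun t => K _ (psi t))).
    exact: ccomp cp.
  rewrite (imF_scale (fun t => (omega t)^-1) (fun t => K _ (psi t))).
  exact: ccomp cq.
- move=> a u v hu hv; have [[bf uf] _] := KP u hu; have [[bg vg] _] := KP v hv.
  rewrite /J (KE _ (fun y => a * K (wT_dist psi omega u) y +
    K (wT_dist psi omega v) y)).
    by apply/funext => t; rewrite /wTinv mulrDr mulrCA.
  split; last exact: is_function_lin uf vg.
  exact: bounded_continuous_lin.
- move=> u v hu hv; have [[bf uf] _] := KP u hu; have [[bg vg] _] := KP v hv.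
  split=> [JE phi sphi|uv].
    have KK : K (wT_dist psi omega u) = K (wT_dist psi omega v).
      have := congr1 (wT psiV omega) JE.
      by rewrite /J !(wTinvK hpsi homega).
    have sT := schwartz_wT hpsi homega sphi.
    have [_ uE] := uf _ sT; have [_ vE] := vg _ sT.
    rewrite -(wTK hpsi homega phi).
    by rewrite -[LHS]/(wT_dist psi omega u _) -[RHS]/(wT_dist psi omega v _) uE vE KK.
  rewrite /J; congr wTinv; apply: KE; split=> // g sg.
  have [jg gE] := vg g sg; split=> //; rewrite -gE.
  exact: (uv _ (wschwartz_wTinv hpsi homega sg)).
- by exists M.
move=> Cs HCs u hu t; have [[bf vf] _] := KP u hu.
have [cp cq _] := bf.
have lf : is_locint_function (wT_dist psi omega u) (K (wT_dist psi omega u)).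
  by split=> //; split; exact: continuous_locally_integrable.
have := HCs _ _ (sobolev_wT_dist hpsi homega hu) lf.
move=> /(bounded_continuous_normc_le bf)/(_ (psi t)); rewrite -normJ.
by rewrite mulrAC ler_pdivlMr// mulrC.
Qed.
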